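(* Let $N,M\ge 1$ be integers and let $\mathcal{A}$ be the bounded operator on $L^2([0,1]^N,\mathbb{C}^M)$ given by $$\mathcal{A}\mathbf{u}=\mathbf{A}_0\mathbf{u}+\mathbf{A}_1\langle \mathbf{B}_1\mathbf{u}\rangle_1+\dots+\mathbf{A}_N\langle \mathbf{B}_N\mathbf{u}\rangle_N ,$$ where $\mathbf{A}_0$ ($M\times M$), $\mathbf{A}_j$ ($M\times M_j$), $\mathbf{B}_j$ ($M_j\times M$), $j=1,\dots,N$, are continuous matrix-valued functions on $[0,1]^N$ and $M_j$ are positive integers. If $\mathcal{A}$ is invertible, then $$\mathcal{A}=(\mathbf{A}_0\cdot)\circ(\mathcal{I}+\mathbf{A}_{1,0}\langle\mathbf{B}_1\cdot\rangle_1)\circ\dots\circ(\mathcal{I}+\mathbf{A}_{N,N-1}\langle\mathbf{B}_N\cdot\rangle_N),$$ and the inverse operator is $$\mathcal{A}^{-1}=(\mathcal{I}-\mathbf{A}_{N,N-1}\mathbf{E}_N^{-1}\langle\mathbf{B}_N\cdot\rangle_N)\circ\dots\circ(\mathcal{I}-\mathbf{A}_{1,0}\mathbf{E}_1^{-1}\langle\mathbf{B}_1\cdot\rangle_1)\circ(\mathbf{A}_0^{-1}\cdot),$$ where the functions $\mathbf{A}_{j,j-1}$, $\mathbf{E}_j$ are defined recursively by $\mathbf{A}_{i,0}=\mathbf{A}_0^{-1}\mathbf{A}_i$ ($1\le i\le N$) and, for $j=1,\dots,N$, $\mathbf{E}_j=\mathbf{I}+\langle\mathbf{B}_j\mathbf{A}_{j,j-1}\rangle_j$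 and $\mathbf{A}_{i,j}=\mathbf{A}_{i,j-1}-\mathbf{A}_{j,j-1}\mathbf{E}_j^{-1}\langle\mathbf{B}_j\mathbf{A}_{i,j-1}\rangle_j$ ($j+1\le i\le N$).
   Context: For $1\le j\le N$, $\langle\cdot\rangle_j:=\int_{[0,1]^j}\cdot\;dk_1\cdots dk_j$ (applied entrywise to scalar-, vector- or matrix-valued functions of $\mathbf{k}=(k_1,\dots,k_N)\in[0,1]^N$); the result depends only on $(k_{j+1},\dots,k_N)$ and is regarded also as a function on $[0,1]^N$ that is constant in $k_1,\dots,k_j$. $\mathbf{A}\cdot$ denotes the operator of multiplication by $\mathbf{A}$, and $\mathbf{A}\langle\mathbf{B}\cdot\rangle_j$ denotes the operator $\mathbf{u}\mapsto\mathbf{A}\langle\mathbf{B}\mathbf{u}\rangle_j$. $\mathcal{I}$ is the identity operator, $\mathbf{I}$ the identity matrix of the appropriate size, $\circ$ is composition. Invertible means invertible as a bounded linear operator on $L^2([0,1]^N,\mathbb{C}^M)$. When $\mathcal{A}$ is invertible, $\mathbf{A}_0$ is invertible at every point of $[0,1]^N$ and each $\mathbf{E}_j$ is invertible at every point of $[0,1]^{N-j}$, so that the recursion makes sense. *)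

(* Defs.v *)
From HB Require Import structures.
From mathcomp Require Import all_boot all_order all_algebra.
From mathcomp Require Import all_classical all_reals all_analysis.
From mathcomp Require Import complex.

Set Implicit Arguments.
Unset Strict Implicit.
Unset Printing Implicit Defensive.

Import Order.TTheory GRing.Theory Num.Theory.
Import numFieldNormedType.Exports.

Local Open Scope classical_set_scope.
Local Open Scope ring_scope.

(* Points of R^n, with the product Borel sigma-algebra of the library. A
   function on [0,1]^n is a total function on [Rpoint R n]; its values outside
   [cube R n] are never used. *)
Notation Rpoint R n := (n.-tuple (measurableTypeR R)).

Section LebesgueTuple.
Context {R : realType}.

Definition point_cons n (z : measurableTypeR R * Rpoint R n) : Rpoint R n.+1 :=
  [tuple of z.1 :: z.2].

Lemma measurable_point_cons n : measurable_fun setT (@point_cons n).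
Proof. exact: measurable_cons. Qed.

Section Step.
Variables (n : nat) (m : {sigma_finite_measure set (Rpoint R n) -> \bar R}).
Variable l : {sigma_finite_measure set (measurableTypeR R) -> \bar R}.

Definition lebesgue_cons : set (Rpoint R n.+1) -> \bar R :=
  pushforward (l \x m)%E (@point_cons n).

Let lebesgue_cons0 : lebesgue_cons set0 = 0%E.
Proof. by rewrite /lebesgue_cons /pushforward preimage_set0 measure0. Qed.

Let lebesgue_cons_ge0 A : (0 <= lebesgue_cons A)%E.
Proof. by rewrite /lebesgue_cons /pushforward; exact: measure_ge0. Qed.

Let lebesgue_cons_sigma_additive : semi_sigma_additive lebesgue_cons.
Proof.
move=> F mF tF mUF; rewrite /lebesgue_cons /pushforward preimage_bigcup.
have mpre A : measurable A -> measurable (@point_cons n @^-1` A).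
  by move=> mA; rewrite -[X in measurable X]setTI; exact: measurable_point_cons.
apply: measure_semi_sigma_additive.
- by move=> i; exact: mpre.
- apply/trivIsetP => /= i j _ _ ij; rewrite -preimage_setI.
  by move/trivIsetP : tF => /(_ _ _ _ _ ij) ->//; rewrite preimage_set0.
- by rewrite -preimage_bigcup; exact: mpre.
Qed.

HB.instance Definition _ := isMeasure.Build _ _ _ lebesgue_cons
  lebesgue_cons0 lebesgue_cons_ge0 lebesgue_cons_sigma_additive.

Let lebesgue_cons_sigma_finite : sigma_finite setT lebesgue_cons.
Proof.
have /sigma_finiteP[F [TF ndF Foo]] := sigma_finiteT l.
have /sigma_finiteP[G [TG ndG Goo]] := sigma_finiteT m.
have FGT : \bigcup_i (F i `*` G i) = setT.
  rewrite -subTset => -[x y] _.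
  have [i _ Fx] : (\bigcup_i F i) x by rewrite -TF.
  have [j _ Gy] : (\bigcup_i G i) y by rewrite -TG.
  exists (maxn i j) => //; split => /=.
  - by move: x Fx; exact/subsetPset/ndF/leq_maxl.
  - by move: y Gy; exact/subsetPset/ndG/leq_maxr.
pose uncons (t : Rpoint R n.+1) : measurableTypeR R * Rpoint R n :=
  (thead t, [tuple of behead t]).
have unconsK z : uncons (point_cons z) = z.
  by case: z => x y; rewrite /uncons /point_cons/= theadE; congr pair; exact: val_inj.
have muncons : measurable_fun setT uncons.
  by apply/measurable_fun_pair; [exact: measurable_tnth|exact: measurable_behead].
exists (fun i => uncons @^-1` (F i `*` G i)).
  by rewrite -preimage_bigcup FGT preimage_setT.
move=> i; have [mF Fioo] := Foo i; have [mG Gioo] := Goo i; split.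
  rewrite -[X in measurable X]setTI; apply: muncons => //; exact: measurableX.
rewrite /lebesgue_cons /pushforward (_ : _ @^-1` _ = F i `*` G i); last first.
  rewrite -comp_preimage (_ : uncons \o @point_cons n = id) ?preimage_id//.
  by apply/funext => z; exact: unconsK.
by rewrite product_measure1E// lte_mul_pinfty// ge0_fin_numE.
Qed.

HB.instance Definition _ := Measure_isSigmaFinite.Build _ _ _ lebesgue_cons
  lebesgue_cons_sigma_finite.

End Step.

(* Lebesgue measure on R^n. *)
Fixpoint lebesgue n : {sigma_finite_measure set (Rpoint R n) -> \bar R} :=
  match n with
  | 0 => \d_[tuple]
  | n'.+1 => lebesgue_cons (lebesgue n') (@lebesgue_measure R)
  end.

End LebesgueTuple.

Definition cube (R : realType) n : set (Rpoint R n) :=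
  [set k | forall i, 0 <= tnth k i <= 1].
Arguments cube : clear implicits.

(* Continuity on [0,1]^N is relative to the cube; the topologies are those of
   the row vectors, of R[i] and of the matrices. *)
Definition continuous_on_cube (R : realType) N p q
    (F : Rpoint R N -> 'M[R[i]]_(p, q)) :=
  {within [set v : 'rV[R]_N | forall i, 0 <= v ord0 i <= 1],
    continuous (fun v => F [tuple v ord0 i | i < N] : 'M[R[i]^o]_(p, q))}.

Section Operators.
Context {R : realType} {N : nat}.
Local Notation C := R[i].
Local Notation pt := (Rpoint R N).

Definition cintegral n (D : set (Rpoint R n)) (f : Rpoint R n -> C) : C :=
  Complex (\int[lebesgue n]_(x in D) complex.Re (f x))
          (\int[lebesgue n]_(x in D) complex.Im (f x)).

(* (x_1, .., x_j, k_{j+1}, .., k_N) *)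
Definition splice j (x : Rpoint R j) (k : pt) : pt :=
  [tuple if (i < j)%N then x`_i else tnth k i | i < N].

Definition avg p q (j : nat) (F : pt -> 'M[C]_(p, q)) (k : pt) : 'M[C]_(p, q) :=
  \matrix_(a, b) cintegral (cube R j) (fun x => F (splice x k) a b).

Definition mul_op p q (F : pt -> 'M[C]_(p, q)) (u : pt -> 'cV[C]_q) :
    pt -> 'cV[C]_p :=
  fun k => F k *m u k.

Definition avg_op p q r (j : nat) (F : pt -> 'M[C]_(p, q))
    (G : pt -> 'M[C]_(q, r)) (u : pt -> 'cV[C]_r) : pt -> 'cV[C]_p :=
  fun k => F k *m avg j (mul_op G u) k.

End Operators.

(* L^2([0,1]^N, C^M) is handled through representatives: square-integrable
   functions up to equality almost everywhere. An operator on it is a map on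
   functions that preserves square integrability and a.e. equality. *)
Section L2.
Context {R : realType} {N M : nat}.
Local Notation C := R[i].
Local Notation fct := (Rpoint R N -> 'cV[C]_M).
Implicit Types (u v : fct) (Phi Psi : fct -> fct).

Definition sqnorm (w : 'cV[C]_M) : R :=
  \sum_(i < M) (complex.Re (w i ord0) ^+ 2 + complex.Im (w i ord0) ^+ 2).

Definition L2 u : Prop :=
  (forall i, measurable_fun (cube R N) (fun k => complex.Re (u k i ord0)) /\
             measurable_fun (cube R N) (fun k => complex.Im (u k i ord0))) /\
  (\int[lebesgue N]_(k in cube R N) (sqnorm (u k))%:E < +oo)%E.

Definition L2norm u : R := Num.sqrt (\int[lebesgue N]_(k in cube R N) sqnorm (u k)).

Definition L2eq u v : Prop := u = v %[ae lebesgue N in cube R N].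

Definition op_eq Phi Psi : Prop := forall u, L2 u -> L2eq (Phi u) (Psi u).

Definition bounded_operator Phi : Prop :=
  [/\ forall u, L2 u -> L2 (Phi u),
      forall u v, L2 u -> L2 v -> L2eq u v -> L2eq (Phi u) (Phi v),
      forall (a : C) u v, L2 u -> L2 v ->
        L2eq (Phi (fun k => a *: u k + v k)) (fun k => a *: Phi u k + Phi v k)
    & exists c : R, forall u, L2 u -> L2norm (Phi u) <= c * L2norm u].

Definition inverse_operator Phi Psi : Prop :=
  [/\ bounded_operator Psi, op_eq (Psi \o Phi) id & op_eq (Phi \o Psi) id].

Definition invertible_operator Phi : Prop := exists Psi, inverse_operator Phi Psi.

End L2.

(* The families A_j, B_j, M_j (1 <= j <= N) are indexed by nat; only their
   values at 1, .., N are used. *)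
Section Recursion.
Context {R : realType} {N M : nat}.
Local Notation C := R[i].
Local Notation pt := (Rpoint R N).
Variables (m : nat -> nat) (A0 : pt -> 'M[C]_M).
Variables (A : forall j, pt -> 'M[C]_(M, m j)) (B : forall j, pt -> 'M[C]_(m j, M)).

Definition integral_op (u : pt -> 'cV[C]_M) : pt -> 'cV[C]_M :=
  fun k => mul_op A0 u k + \sum_(1 <= j < N.+1) avg_op j (A j) (B j) u k.

Definition Egen j (X : pt -> 'M[C]_(M, m j)) (k : pt) : 'M[C]_(m j) :=
  1%:M + avg j (fun k' => B j k' *m X k') k.

(* [Arec j i] is A_{i,j} *)
Fixpoint Arec (j : nat) : forall i, pt -> 'M[C]_(M, m i) :=
  match j with
  | 0 => fun i k => invmx (A0 k) *m A i k
  | j'.+1 => fun i k =>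
      Arec j' i k -
      Arec j' j'.+1 k *m invmx (Egen (Arec j' j'.+1) k)
        *m avg j'.+1 (fun k' => B j'.+1 k' *m Arec j' i k') k
  end.

Definition Emx j : pt -> 'M[C]_(m j) := Egen (Arec j.-1 j).

Definition factor_op j (u : pt -> 'cV[C]_M) : pt -> 'cV[C]_M :=
  fun k => u k + avg_op j (Arec j.-1 j) (B j) u k.

Definition inv_factor_op j (u : pt -> 'cV[C]_M) : pt -> 'cV[C]_M :=
  fun k => u k - avg_op j (fun k' => Arec j.-1 j k' *m invmx (Emx j k')) (B j) u k.

(* factor_op 1 \o .. \o factor_op N *)
Definition factors_op : (pt -> 'cV[C]_M) -> (pt -> 'cV[C]_M) :=
  \big[comp/id]_(j <- index_iota 1 N.+1) factor_op j.

(* inv_factor_op N \o .. \o inv_factor_op 1 *)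
Definition inv_factors_op : (pt -> 'cV[C]_M) -> (pt -> 'cV[C]_M) :=
  \big[comp/id]_(j <- rev (index_iota 1 N.+1)) inv_factor_op j.

End Recursion.

(* Main.v *)
Require Import Defs.
From mathcomp Require Import all_boot all_order all_algebra.
From mathcomp Require Import all_classical all_reals all_analysis.
From mathcomp Require Import complex measurable_realfun ring lra.

Set Implicit Arguments.
Unset Strict Implicit.
Unset Printing Implicit Defensive.

Import Order.TTheory GRing.Theory Num.Theory.
Import numFieldNormedType.Exports.

Local Open Scope classical_set_scope.
Local Open Scope ring_scope.

(* With [T_j u = u + sum_(i > j) A_{i,j} <B_i u>_i], one has [A = A_0 T_0] and
   [T_j = (I + A_{j+1,j} <B_{j+1} .>_{j+1}) T_{j+1}]: an average [<B_i u>_i] with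
   [i > j] does not depend on [k_1, .., k_j], so it can be pulled out of [< . >_j].
   Each factor is inverted by hand once [E_j] is pointwise invertible; the inverse
   of the product is the product of the inverses, and [T_N = I].

   Pointwise invertibility of [E_{j+1}] only uses that [T_j] is bounded below in
   L^2, a property that passes from [T_j] to [T_{j+1}] because the factor between
   them is bounded. If [E(k0) w = 0] with [w <> 0], let [chi] be the indicator of
   a small box around [(k0_{j+2}, .., k0_N)], and test [T_j] on
   [u = chi A_{j+1,j} w]: the rank-one part yields [chi A_{j+1,j} E w], small by
   continuity of [E], and the averages with [i > j + 1] integrate [chi] over a
   coordinate where it has small width. But [|u|] is not small, since
   [<B_{j+1} u>_{j+1} = chi (E - I) w] is close to [- chi w]. The invertibility of
   [A_0] is the same argument for [j = 0], [A_0 = I + (A_0 - I) <I .>_0]. *)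

(** * Fubini on the cube *)

(** The recursion for [A_{i,j}] is forced. For [T_j] to split off its first factor, the coefficients
    must satisfy [A_{i,j+1} + A_{j+1,j} <B_{j+1} A_{i,j+1}>_{j+1} = A_{i,j}]; multiplying by
    [B_{j+1}] and averaging gives [E_{j+1} <B_{j+1} A_{i,j+1}>_{j+1} = <B_{j+1} A_{i,j}>_{j+1}],
    hence the formula. A lower bound is the part of invertibility that a test function can
    contradict, and it is inherited by the right factor of a product without any information on
    surjectivity. The box leaves [k_1, .., k_{j+1}] free so that [chi] commutes with [< . >_{j+1}].
    Every squared norm is compared with the volume of the box, a positive common factor that cancels
    at the end; each longer average gains a factor proportional to the width. The elements of L^2
    are representatives, and the sections of an L^2 function are integrable only for almost every
    [k]. Linearity of an average therefore holds almost everywhere when [u] is involved, but at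
    every point of the cube for the continuous coefficients; this decides which identities are
    pointwise and which are almost everywhere. *)

Section SectionIntegral.
Context d1 d2 (T1 : measurableType d1) (T2 : measurableType d2) (R : realType).
Variables (m1 : {sigma_finite_measure set T1 -> \bar R}).
Variables (m2 : {sigma_finite_measure set T2 -> \bar R}).
Variables (D1 : set T1) (D2 : set T2) (f : T1 -> T2 -> \bar R).
Hypotheses (mD1 : measurable D1) (mD2 : measurable D2).
Hypothesis mf : measurable_fun (D1 `*` D2) (fun z => f z.1 z.2).
Hypothesis f0 : forall x y, D1 x -> D2 y -> (0 <= f x y)%E.

(** Extension by zero reduces integrals over a rectangle to Tonelli's theorem on the whole
    product. *)
Let g := (fun z => f z.1 z.2) \_ (D1 `*` D2).

Let mg : measurable_fun setT g.
Proof. exact/(measurable_restrictT _ (measurableX mD1 mD2)). Qed.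

Let g0 z : (0 <= g z)%E.
Proof.
by rewrite /g patchE; case: ifPn => // /set_mem [? ?]; exact: f0.
Qed.

Let sect1 x : D1 x -> (\int[m2]_(y in D2) f x y = \int[m2]_y g (x, y))%E.
Proof.
move=> Dx; rewrite integral_mkcond; apply: eq_integral => y _.
rewrite /g !patchE; have [Dy|Dy] := pselect (D2 y).
  by rewrite !mem_set.
by rewrite !memNset// => -[].
Qed.

Let sect2 y : D2 y -> (\int[m1]_(x in D1) f x y = \int[m1]_x g (x, y))%E.
Proof.
move=> Dy; rewrite integral_mkcond; apply: eq_integral => x _.
rewrite /g !patchE; have [Dx|Dx] := pselect (D1 x).
  by rewrite !mem_set.
by rewrite !memNset// => -[].
Qed.

Lemma measurable_section_integral :
  measurable_fun D1 (fun x => \int[m2]_(y in D2) f x y)%E.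
Proof.
apply: (eq_measurable_fun (fun x => \int[m2]_y g (x, y))%E).
  by move=> x /set_mem Dx; rewrite sect1.
exact/measurable_funTS/measurable_fun_fubini_tonelli_F.
Qed.

Lemma section_integral_swap :
  (\int[m1]_(x in D1) \int[m2]_(y in D2) f x y =
   \int[m2]_(y in D2) \int[m1]_(x in D1) f x y)%E.
Proof.
transitivity (\int[m1]_x \int[m2]_y g (x, y))%E.
  rewrite integral_mkcond; apply: eq_integral => x _; rewrite patchE.
  case: ifPn => [/set_mem Dx|/negP nDx]; first by rewrite sect1.
  rewrite integral0_eq// => y _; rewrite /g patchE memNset// => -[Dx _].
  by apply: nDx; rewrite mem_set.
rewrite fubini_tonelli//; apply/esym.
rewrite integral_mkcond; apply: eq_integral => y _; rewrite patchE.
case: ifPn => [/set_mem Dy|/negP nDy]; first by rewrite sect2.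
rewrite integral0_eq// => x _; rewrite /g patchE memNset// => -[_ Dy].
by apply: nDy; rewrite mem_set.
Qed.

Lemma integral_product_sections :
  (\int[m1 \x m2]_(z in D1 `*` D2) f z.1 z.2 =
   \int[m1]_(x in D1) \int[m2]_(y in D2) f x y)%E.
Proof.
rewrite integral_mkcond fubini_tonelli1//; apply/esym.
rewrite integral_mkcond; apply: eq_integral => x _; rewrite patchE.
case: ifPn => [/set_mem Dx|/negP nDx]; first by rewrite sect1.
apply/esym/integral0_eq => y _; rewrite patchE memNset// => -[Dx _].
by apply: nDx; rewrite mem_set.
Qed.

End SectionIntegral.

Section CubeIntegral.
Context {R : realType}.
Local Notation leb := (@lebesgue_measure R).
Local Notation I01 := (`[0%R, 1%R]%classic : set (measurableTypeR R)).

Lemma measurable_cube n : measurable (cube R n).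
Proof.
rewrite (_ : cube R n =
  \bigcap_(i in [set: 'I_n]) ((@tnth _ (measurableTypeR R) ^~ i) @^-1` I01)).
  apply: fin_bigcap_measurable => // i _.
  rewrite -[X in measurable X]setTI; apply: measurable_tnth => //.
apply/seteqP; split => k kP i.
  by move=> _; rewrite /= in_itv/=; exact: kP.
by have := kP i I; rewrite /= in_itv.
Qed.
#[local] Hint Extern 0 => match goal with
  | |- _ (cube _ _) => solve [exact: measurable_cube]
  | |- _ [set` _] => solve [exact: measurable_itv] end : core.

Lemma cube_cons n t (k : Rpoint R n) :
  cube R n.+1 [tuple of t :: k] <-> I01 t /\ cube R n k.
Proof.
rewrite /= in_itv/=; split => [h|[ht hk] i].
  split; first by have := h ord0; rewrite tnth0.
  by move=> i; have := h (lift ord0 i); rewrite tnthS.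
by case: (unliftP ord0 i) => [j ->|->]; rewrite ?tnthS ?tnth0.
Qed.

Lemma integral_cube0 (f : Rpoint R 0 -> \bar R) :
  (\int[lebesgue 0]_(x in cube R 0) f x = f [tuple])%E.
Proof.
rewrite /= (integral_dirac _ (@measurable_cube 0))//; last first.
  (* On a one-point space every preimage is empty or everything, so measurability is automatic. *)
  move=> _ Y _; rewrite (_ : _ `&` _ = if `[< Y (f [tuple]) >] then setT else set0).
    by case: ifP.
  apply/seteqP; split => x; rewrite (tuple0 x).
    by move=> [_ /= Yf]; case: asboolP.
  by case: asboolP => // Yf _; split => // -[].
by rewrite diracE mem_set ?mul1e// => -[].
Qed.

(** The measure [lebesgue n.+1] is built as the image of a product under [point_cons]: a change of
    variables followed by Tonelli separates the first coordinate. *)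
Lemma integral_cubeS n (f : Rpoint R n.+1 -> \bar R) :
  measurable_fun (cube R n.+1) f ->
  (forall x, cube R n.+1 x -> 0 <= f x)%E ->
  (\int[lebesgue n.+1]_(x in cube R n.+1) f x =
   \int[leb]_(t in I01) \int[lebesgue n]_(x in cube R n) f [tuple of t :: x])%E.
Proof.
move=> mf f0; rewrite /= [LHS](ge0_integral_pushforward (@measurable_point_cons R n) _
  (@measurable_cube n.+1) mf); last by move=> x /set_mem; exact: f0.
rewrite (_ : _ @^-1` _ = I01 `*` cube R n); last first.
  by apply/seteqP; split => -[t x] /cube_cons.
rewrite (@integral_product_sections _ _ _ _ _ leb (lebesgue n) I01 (cube R n)
  (fun t x => f (point_cons (t, x))))//.
- apply: (@measurable_comp _ _ _ _ _ _ (cube R n.+1) f) => //.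
    by move=> _ [[t x] /= tx <-]; exact/cube_cons.
  apply: measurable_funTS.
  rewrite (_ : (fun _ => _) = @point_cons R n); last by apply/funext => -[].
  exact: measurable_point_cons.
- by move=> t x It cx; apply/f0/cube_cons.
Qed.

Lemma measurable_splice N j d (T : measurableType d) (x : T -> Rpoint R j)
    (k : T -> Rpoint R N) :
  measurable_fun setT x -> measurable_fun setT k ->
  measurable_fun setT (fun t => splice (x t) (k t)).
Proof.
move=> mx mk; apply/measurable_fun_tnthP => i; rewrite /comp/=.
under eq_fun do rewrite tnth_mktuple.
have [ij|ji] := ltnP i j.
  under eq_fun do rewrite -(tnth_nth 0 _ (Ordinal ij)).
  exact: measurableT_comp (measurable_tnth _) mx.
exact: measurableT_comp (measurable_tnth _) mk.
Qed.

Lemma cube_splice N j (x : Rpoint R j) (k : Rpoint R N) :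
  cube R j x -> cube R N k -> cube R N (splice x k).
Proof.
move=> cx ck i; rewrite tnth_mktuple; case: ltnP => // ij.
by rewrite -(tnth_nth 0 x (Ordinal ij)).
Qed.

Lemma splice0 N (x : Rpoint R 0) (k : Rpoint R N) : splice x k = k.
Proof. by apply: eq_from_tnth => i; rewrite tnth_mktuple. Qed.

Lemma splice_cons N j s t (x : Rpoint R j) (k : Rpoint R N) :
  splice [tuple of s :: x] [tuple of t :: k] = [tuple of s :: splice x k].
Proof.
apply: eq_from_tnth => i; rewrite tnth_mktuple.
by case: (unliftP ord0 i) => [l ->|->]; rewrite ?tnthS ?tnth0// tnth_mktuple.
Qed.

Lemma measurable_cube_splice N j d (T : measurableType d) (f : Rpoint R N -> T) :
  measurable_fun (cube R N) f ->
  measurable_fun (cube R N `*` cube R j)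
    (fun z => f (splice z.2 z.1)).
Proof.
move=> mf; apply: (@measurable_comp _ _ _ _ _ _ (cube R N) f) => //.
  by move=> _ [[k x] /= [ck cx] <-]; exact: cube_splice.
by apply: measurable_funTS; exact: measurable_splice.
Qed.

Lemma measurable_avg N j (f : Rpoint R N -> \bar R) :
  measurable_fun (cube R N) f -> (forall k, cube R N k -> 0 <= f k)%E ->
  measurable_fun (cube R N)
    (fun k => \int[lebesgue j]_(x in cube R j) f (splice x k))%E.
Proof.
move=> mf f0; apply: measurable_section_integral => //.
- exact: measurable_cube_splice.
- by move=> k x ck cx; exact/f0/cube_splice.
Qed.

Lemma measurable_cube_cons n d (T : measurableType d) (f : Rpoint R n.+1 -> T) :
  measurable_fun (cube R n.+1) f ->
  measurable_fun (I01 `*` cube R n) (fun z => f [tuple of z.1 :: z.2]).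
Proof.
move=> mf; apply: (@measurable_comp _ _ _ _ _ _ (cube R n.+1) f) => //.
  by move=> _ [[t x] /= tx <-]; exact/cube_cons.
by apply: measurable_funTS; exact: measurable_point_cons.
Qed.

Lemma lebesgue_I01 : leb I01 = 1%E.
Proof. by rewrite lebesgue_measure_itv/= lte_fin ltr01 oppr0 adde0. Qed.

Lemma integral_I01_cst (c : \bar R) : (\int[leb]_(t in I01) c = c)%E.
Proof. by rewrite (integral_cst leb _ c)// [X in (_ * X)%E]lebesgue_I01 mule1. Qed.

(* After Fubini, the outer integral over k_1, .., k_j has mass 1 and drops out. *)
Lemma integral_avg N j (f : Rpoint R N -> \bar R) : (j <= N)%N ->
  measurable_fun (cube R N) f -> (forall k, cube R N k -> 0 <= f k)%E ->
  (\int[lebesgue N]_(k in cube R N) \int[lebesgue j]_(x in cube R j) f (splice x k)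
   = \int[lebesgue N]_(k in cube R N) f k)%E.
Proof.
elim: j N f => [|j IH] N f.
  by move=> _ mf f0; apply: eq_integral => k _; rewrite integral_cube0 splice0.
case: N f => // N f; rewrite ltnS => jN mf f0.
have fc0 s k : I01 s -> cube R N k -> (0 <= f [tuple of s :: k])%E.
  by move=> Is ck; apply/f0/cube_cons.
have mfs : measurable_fun ((I01 `*` cube R N) `*` cube R j)
    (fun z => f [tuple of z.1.1 :: splice z.2 z.1.2]).
  apply: (@measurable_comp _ _ _ _ _ _ (cube R N.+1) f) => //.
    move=> _ [[[t k] x] /= [[It ck] cx] <-]; apply/cube_cons; split => //.
    exact: cube_splice.
  apply: measurable_funTS; apply: measurable_cons.
    exact: measurableT_comp measurable_fst measurable_fst.
  apply: measurable_splice; first exact: measurable_snd.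
  exact: measurableT_comp measurable_snd measurable_fst.
rewrite !integral_cubeS//; last 2 first.
- exact: measurable_avg.
- by move=> k ck; apply: integral_ge0 => x cx; exact/f0/cube_splice.
(* [splice] overwrites the first coordinate, so the inner average does not see [t]; the integral
   over [t] is then that of a constant. *)
have E1 t k : I01 t -> cube R N k ->
  (\int[lebesgue j.+1]_(x in cube R j.+1) f (splice x [tuple of t :: k]) =
   \int[leb]_(s in I01) \int[lebesgue j]_(x in cube R j) f [tuple of s :: splice x k])%E.
  move=> It ck; rewrite integral_cubeS//; last 2 first.
  - apply: (@measurable_comp _ _ _ _ _ _ (cube R N.+1) f) => //.
      by move=> _ [x /= cx <-]; apply: cube_splice => //; exact/cube_cons.
    by apply: measurable_funTS; exact: measurable_splice.
  - by move=> x cx; apply/f0/cube_splice => //; exact/cube_cons.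
  by apply: eq_integral => s _; apply: eq_integral => x _; rewrite splice_cons.
transitivity (\int[leb]_(t in I01) \int[lebesgue N]_(k in cube R N)
  \int[leb]_(s in I01) \int[lebesgue j]_(x in cube R j) f [tuple of s :: splice x k])%E.
  apply: eq_integral => t /set_mem It; apply: eq_integral => k /set_mem ck.
  exact: E1.
rewrite integral_I01_cst.
(* After exchanging [s] and [k], each fixed [s] leaves an average over [j] coordinates of a function
   of [N] variables, which is the induction hypothesis. *)
rewrite -(@section_integral_swap _ _ _ _ _ leb (lebesgue N) I01 (cube R N)
  (fun s k => \int[lebesgue j]_(x in cube R j) f [tuple of s :: splice x k])%E)//.
- apply: eq_integral => s /set_mem Is.
  apply: (IH N (fun k => f [tuple of s :: k])) => //.
  + apply: (@measurable_comp _ _ _ _ _ _ (cube R N.+1) f) => //.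
      by move=> _ [x /= cx <-]; apply/cube_cons.
    by apply: measurable_funTS; exact: measurable_cons.
  + by move=> k ck; exact: fc0.
- apply: (@measurable_section_integral _ _ _ _ _ (lebesgue j) (I01 `*` cube R N) (cube R j)
    (fun z x => f [tuple of z.1 :: splice x z.2])) => //.
  + exact: measurableX.
  + by move=> [s k] x [Is ck] cx; apply: fc0 => //; exact: cube_splice.
- move=> s k Is ck; apply: integral_ge0 => x cx.
  by apply: fc0 => //; exact: cube_splice.
Qed.

End CubeIntegral.

#[local] Hint Extern 0 => match goal with
  | |- _ (cube _ _) => solve [exact: measurable_cube]
  | |- _ [set` _] => solve [exact: measurable_itv] end : core.

(** * Square-integrable functions on a set of mass 1 *)

Section Jensen.
Context d (T : measurableType d) (R : realType) (mu : {measure set T -> \bar R}).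
Variable D : set T.
Hypotheses (mD : measurable D) (muD : mu D = 1%E).

Lemma prob_integrable_cst (c : R) : mu.-integrable D (EFin \o cst c).
Proof.
apply/integrableP; split; first exact/measurable_EFinP.
by rewrite (integral_cst mu mD `|c|%:E) muD mule1 ltry.
Qed.

Lemma prob_bounded_integrable (f : T -> R) (c : R) :
  measurable_fun D f -> (forall x, D x -> `|f x| <= c) ->
  mu.-integrable D (EFin \o f).
Proof.
move=> mf fc; apply: (le_integrable mD _ _ (prob_integrable_cst c)).
  exact/measurable_EFinP.
move=> x Dx /=; rewrite lee_fin; apply: le_trans (fc x Dx) _; exact: ler_norm.
Qed.

Lemma prob_Rintegral_cst (c : R) : \int[mu]_(x in D) c = c.
Proof. by rewrite Rintegral_cst// muD mulr1. Qed.

Lemma sqr_integrable (f : T -> R) : measurable_fun D f ->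
  (\int[mu]_(x in D) (f x ^+ 2)%:E < +oo)%E ->
  mu.-integrable D (EFin \o (fun x => f x ^+ 2)).
Proof.
move=> mf foo; apply/integrableP; split.
  exact/measurable_EFinP/measurable_funX.
by under eq_integral do rewrite /= ger0_norm ?sqr_ge0//.
Qed.

(** Constants are integrable because the mass is 1, and $2|f| \le 1 + f^2$ dominates [f]. *)
Lemma prob_integrable_sqr (f : T -> R) : measurable_fun D f ->
  (\int[mu]_(x in D) (f x ^+ 2)%:E < +oo)%E -> mu.-integrable D (EFin \o f).
Proof.
move=> mf foo.
have if2 := integrableD mD (prob_integrable_cst 1) (sqr_integrable mf foo).
apply: (le_integrable mD _ _ if2); first exact/measurable_EFinP.
move=> x Dx /=; rewrite lee_fin [leRHS]ger0_norm ?addr_ge0 ?sqr_ge0//.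
have := sqr_ge0 (`|f x| - 1); rewrite sqrrB real_normK ?num_real// => h.
have := normr_ge0 (f x); lra.
Qed.

(** The variance is nonnegative: integrate $(f - t)^2$ with [t] the mean. An infinite right-hand
    side leaves nothing to prove; a finite one makes [f] integrable, so the square can be expanded
    under the integral. *)
Lemma prob_jensen_sqr (f : T -> R) : measurable_fun D f ->
  (((\int[mu]_(x in D) f x) ^+ 2)%:E <= \int[mu]_(x in D) (f x ^+ 2)%:E)%E.
Proof.
move=> mf; have [foo|] := ltP (\int[mu]_(x in D) (f x ^+ 2)%:E)%E +oo%E; last first.
  by rewrite leye_eq => /eqP ->; rewrite leey.
have if1 := prob_integrable_sqr mf foo.
have if2 := sqr_integrable mf foo.
set t := \int[mu]_(x in D) f x.
have : 0 <= \int[mu]_(x in D) ((f x ^+ 2 + (- 2 * t) * f x) + t ^+ 2).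
  apply: Rintegral_ge0 => x Dx.
  rewrite (_ : _ + _ = (f x - t) ^+ 2) ?sqr_ge0//; ring.
have if3 : mu.-integrable D (EFin \o (fun x => (- 2 * t) * f x)).
  rewrite (_ : _ \o _ = (fun x => (- 2 * t)%:E * (EFin \o f) x)%E).
    exact: integrableZl.
  by apply/funext => x; rewrite /= EFinM.
rewrite RintegralD//; first last.
- exact: prob_integrable_cst.
- exact: (integrableD mD if2 if3).
rewrite RintegralD// RintegralZl// prob_Rintegral_cst -/t => h.
rewrite -[leRHS]fineK; last first.
  by rewrite ge0_fin_numE// integral_ge0// => x _; rewrite lee_fin sqr_ge0.
rewrite lee_fin; move: h; rewrite /Rintegral; set s := fine _; lra.
Qed.

End Jensen.

(** * Averages of real functions, and the measure of slabs and boxes *)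

Section RealAvg.
Context {R : realType}.
Local Notation leb := (@lebesgue_measure R).
Local Notation I01 := (`[0%R, 1%R]%classic : set (measurableTypeR R)).

Lemma lebesgue_cube n : lebesgue n (cube R n) = 1%E.
Proof.
have cst1 k : (\int[lebesgue k]_(x in cube R k) 1 = lebesgue k (cube R k))%E.
  by rewrite (integral_cst _ _ 1%E)// mul1e.
elim: n => [|n IH]; rewrite -cst1; first by rewrite integral_cube0.
rewrite integral_cubeS//.
by under eq_integral do rewrite cst1 IH; rewrite integral_I01_cst.
Qed.

Lemma integral_cube_cst n (c : \bar R) :
  (\int[lebesgue n]_(x in cube R n) c = c)%E.
Proof.
by rewrite (integral_cst _ (@measurable_cube R n) c) [X in (_ * X)%E]lebesgue_cube mule1.
Qed.

Definition ravg N j (f : Rpoint R N -> R) (k : Rpoint R N) : R :=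
  \int[lebesgue j]_(x in cube R j) f (splice x k).

Section Fixed.
Variables (N j : nat).
Implicit Types (f g : Rpoint R N -> R).

Lemma measurable_splice_section f k : cube R N k -> measurable_fun (cube R N) f ->
  measurable_fun (cube R j) (fun x => f (splice x k)).
Proof.
move=> ck mf; apply: (@measurable_comp _ _ _ _ _ _ (cube R N) f) => //.
  by move=> _ [x /= cx <-]; exact: cube_splice.
by apply: measurable_funTS; exact: measurable_splice.
Qed.

(** Tonelli gives measurability for nonnegative functions, so the positive and negative parts are
    averaged separately. *)
Lemma measurable_ravg f : measurable_fun (cube R N) f ->
  measurable_fun (cube R N) (ravg j f).
Proof.
move=> mf; rewrite /ravg /Rintegral.
apply: (measurableT_comp (fine_measurable measurableT)).
apply: (eq_measurable_fun (fun k =>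
  \int[lebesgue j]_(x in cube R j) (EFin \o f)^\+%E (splice x k) -
  \int[lebesgue j]_(x in cube R j) (EFin \o f)^\-%E (splice x k))%E).
  move=> k _; rewrite [RHS]integralE.
  by congr (_ - _)%E; apply: eq_integral => x _; rewrite ?funeposE ?funenegE.
have mEf : measurable_fun (cube R N) (EFin \o f) by exact/measurable_EFinP.
apply: emeasurable_funB; apply: measurable_avg => //.
- exact: measurable_funepos.
- exact: measurable_funeneg.
Qed.

Lemma ravg_sqr_le f k : cube R N k -> measurable_fun (cube R N) f ->
  ((ravg j f k ^+ 2)%:E <=
   \int[lebesgue j]_(x in cube R j) (f (splice x k) ^+ 2)%:E)%E.
Proof.
move=> ck mf; apply: prob_jensen_sqr => //; first exact: lebesgue_cube.
exact: measurable_splice_section.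
Qed.

(** The section averages of $f^2$ have a finite integral by [integral_avg], so they are finite
    almost everywhere, and a square-integrable section on a cube of mass 1 is integrable. *)
Lemma ae_splice_integrable f : (j <= N)%N -> measurable_fun (cube R N) f ->
  (\int[lebesgue N]_(k in cube R N) (f k ^+ 2)%:E < +oo)%E ->
  \forall k \ae (lebesgue N : set (Rpoint R N) -> \bar R), cube R N k ->
    (lebesgue j).-integrable (cube R j) (fun x => (f (splice x k))%:E).
Proof.
move=> jN mf foo.
have mf2 : measurable_fun (cube R N) (fun k => (f k ^+ 2)%:E).
  exact/measurable_EFinP/measurable_funX.
have f20 k : cube R N k -> (0 <= (f k ^+ 2)%:E)%E by rewrite lee_fin sqr_ge0.
have : (lebesgue N).-integrable (cube R N)
    (fun k => \int[lebesgue j]_(x in cube R j) (f (splice x k) ^+ 2)%:E)%E.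
  apply/integrableP; split; first exact: (@measurable_avg R N j (fun k => (f k ^+ 2)%:E)).
  under eq_integral => k _.
    rewrite gee0_abs; last by apply: integral_ge0 => x _; rewrite lee_fin sqr_ge0.
    over.
  by rewrite (@integral_avg R N j (fun k => (f k ^+ 2)%:E)).
move/(integrable_ae (@measurable_cube R N)); apply: filterS => k h ck.
apply: (prob_integrable_sqr (@measurable_cube R j) (lebesgue_cube j)).
  exact: measurable_splice_section.
by rewrite -ge0_fin_numE ?h// integral_ge0// => x _; rewrite lee_fin sqr_ge0.
Qed.

End Fixed.

Lemma measurable_itv01_near (a d : R) : measurable [set t : measurableTypeR R | `|t - a| <= d].
Proof.
rewrite (_ : mkset _ = [set` `[a - d, a + d]])//.
by apply/seteqP; split => t /=; rewrite in_itv/= ler_distl.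
Qed.

Lemma measurable_slab n (l : 'I_n) (a d : R) :
  measurable [set x : Rpoint R n | `|tnth x l - a| <= d].
Proof.
rewrite -[X in measurable X]setTI.
exact: (measurable_tnth l measurableT (measurable_itv01_near a d)).
Qed.

(** Only coordinate [l] is constrained, to an interval of length at most [2d]; the other coordinates
    contribute mass 1. The induction peels the first coordinate, which either is [l] or integrates
    to 1. *)
Lemma integral_slab_le n (l : 'I_n) (a d : R) : 0 <= d ->
  (\int[lebesgue n]_(x in cube R n) (\1_[set x | `|tnth x l - a| <= d] x)%:E
   <= (d *+ 2)%:E)%E.
Proof.
move=> d0; elim: n l => [[]//|n IH] l.
have := @measurable_slab _ l a d; set A := mkset _ => mA.
rewrite integral_cubeS//; last exact/measurable_EFinP/measurable_indic.
have [l' El|El] := unliftP ord0 l.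
  rewrite -[leRHS]integral_I01_cst.
  have E (t : measurableTypeR R) (x : Rpoint R n) : \1_A [tuple of t :: x] = \1_[set x | `|tnth x l' - a| <= d] x :> R.
    rewrite !indicE; congr (nat_of_bool _)%:R.
  by apply/idP/idP => /set_mem h; apply/mem_set; move: h; rewrite /A/= El tnthS.
  apply: ge0_le_integral => //.
  - by move=> t _; apply: integral_ge0 => x _; rewrite lee_fin indicE.
  - apply: measurable_section_integral => //.
    apply: (@measurable_cube_cons R n _ _ (fun x => (\1_A x)%:E)).
    exact/measurable_EFinP/measurable_indic.
  - by move=> t _; under eq_integral do rewrite E; exact: IH.
have E (t : measurableTypeR R) (x : Rpoint R n) : \1_A [tuple of t :: x] = \1_[set t | `|t - a| <= d] t :> R.
  rewrite !indicE; congr (nat_of_bool _)%:R.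
  by apply/idP/idP => /set_mem h; apply/mem_set; move: h; rewrite /A/= El tnth0.
under eq_integral => t _.
  under eq_integral do rewrite E.
  rewrite integral_cube_cst.
  over.
rewrite integral_indic//; last exact: measurable_itv01_near.
apply: (@le_trans _ _ (leb [set` `[a - d, a + d]])).
  apply: le_measure; rewrite ?inE//.
    by apply: measurableI => //; exact: measurable_itv01_near.
  by move=> t [/=]; rewrite in_itv/= ler_distl.
rewrite lebesgue_measure_itv/=; case: ifP => _; last by rewrite lee_fin mulrn_wge0.
by rewrite lee_fin; lra.
Qed.

(** Indices start at 0, so [j <= i] constrains $k_{j+1}, \dots, k_N$ and leaves $k_1, \dots, k_j$
    free: the box is unchanged by splicing the first [j] coordinates. *)
Definition box N j (a : Rpoint R N) (d : R) : set (Rpoint R N) :=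
  [set k | forall i : 'I_N, (j <= i)%N -> `|tnth k i - tnth a i| <= d].

Lemma measurable_box N j (a : Rpoint R N) d : measurable (box j a d).
Proof.
rewrite (_ : box j a d = \bigcap_(i in [set i : 'I_N | (j <= i)%N])
  [set k : Rpoint R N | `|tnth k i - tnth a i| <= d]).
  by apply: fin_bigcap_measurable => // i _; exact: measurable_slab.
by apply/seteqP; split.
Qed.

(** Each coordinate contributes a factor at least [d], wherever the centre lies in the cube. *)
Lemma integral_box_ge N (a : Rpoint R N) (d : R) : cube R N a -> 0 < d -> d <= 2^-1 ->
  ((d ^+ N)%:E <= \int[lebesgue N]_(x in cube R N) (\1_(box 0 a d) x)%:E)%E.
Proof.
move=> ca d0 d1; elim: N a ca => [|n IH] a ca.
  by rewrite integral_cube0 expr0 indicE mem_set// => -[].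
have [a0 [a' Ea]] : exists (a0 : measurableTypeR R) (a' : Rpoint R n), a = [tuple of a0 :: a'].
  by exists (thead a), [tuple of behead a]; exact: tuple_eta.
rewrite {}Ea in ca *; have [Ia0 ca'] := (cube_cons a0 a').1 ca.
have mb := @measurable_box _ 0 [tuple of a0 :: a'] d.
rewrite integral_cubeS//; last exact/measurable_EFinP/measurable_indic.
have E (t : measurableTypeR R) (x : Rpoint R n) : (\1_(box 0 [tuple of a0 :: a'] d) [tuple of t :: x])%:E =
  ((\1_[set t | `|t - a0| <= d] t)%:E * (\1_(box 0 a' d) x)%:E)%E :> \bar R.
  rewrite -EFinM; congr EFin; rewrite !indicE -natrM mulnb; congr (nat_of_bool _)%:R.
  apply/idP/andP => [/set_mem h|[/set_mem h1 /set_mem h2]]; last apply/mem_set.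
    split; apply/mem_set; first by have := h ord0 isT; rewrite !tnth0.
    by move=> i _; have := h (lift ord0 i) isT; rewrite !tnthS.
  by move=> i _; case: (unliftP ord0 i) => [i' ->|->]; rewrite ?tnth0// !tnthS; exact: h2.
have : ((d ^+ n)%:E * \int[leb]_(t in I01) (\1_[set t | `|t - a0| <= d] t)%:E <=
   \int[leb]_(t in I01) \int[lebesgue n]_(x in cube R n)
     (\1_(box 0 [tuple of a0 :: a'] d) [tuple of t :: x])%:E)%E.
  have mI : measurable_fun I01 (fun t : measurableTypeR R => (\1_[set t | `|t - a0| <= d] t : R)%:E).
    apply/measurable_EFinP; apply: measurable_indic; exact: measurable_itv01_near.
  have dn0 : 0 <= d ^+ n by rewrite exprn_ge0// ltW.
  rewrite -ge0_integralZl_EFin//.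
  apply: ge0_le_integral => //.
  - by move=> t _; rewrite mule_ge0.
  - exact: measurable_funeM.
  - apply: measurable_section_integral => //.
    apply: (@measurable_cube_cons R n _ _ (fun x => (\1_(box 0 [tuple of a0 :: a'] d) x)%:E)).
    exact/measurable_EFinP/measurable_indic.
  - move=> t _; under eq_integral do rewrite E.
    rewrite ge0_integralZl_EFin//.
    + by rewrite muleC lee_wpmul2l// IH.
    + apply/measurable_EFinP; apply: measurable_indic; exact: measurable_box.
apply: le_trans; rewrite exprSr EFinM lee_pmul2l ?lte_fin ?exprn_gt0//.
rewrite integral_indic//; last exact: measurable_itv01_near.
move: Ia0; rewrite /= in_itv/= => /andP[a00 a01].
(* Near an endpoint only half of the interval around [a0] lies in [0,1]. Since [d] is at most 1/2,
   the half on the right fits when [a0] is at most 1/2, and the half on the left otherwise. *)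
have [c cI] : exists c : R,
    [set` `[c, c + d]] `<=` [set t | `|t - a0| <= d] `&` I01.
  have [ha|ha] := leP a0 2^-1.
    exists a0 => t /=; rewrite !in_itv/= ler_distl => /andP[h1 h2].
    by split; apply/andP; split; lra.
  exists (a0 - d) => t /=; rewrite !in_itv/= ler_distl => /andP[h1 h2].
  by split; apply/andP; split; lra.
apply: (@le_trans _ _ (leb [set` `[c, c + d]])).
  rewrite lebesgue_measure_itv/= lte_fin ltrDl d0 lee_fin; lra.
apply: le_measure; rewrite ?inE//.
by apply: measurableI => //; exact: measurable_itv01_near.
Qed.

End RealAvg.

(** * Uniform continuity *)

Section UniformContinuity.
Context {R : realType} {N : nat}.
Local Notation pt := (Rpoint R N).
Implicit Types (f g : pt -> R).

(** Continuity is written with epsilon and delta in the coordinates of the tuple. [pcont] is its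
    pointwise form; the two agree on the cube by compactness. *)
Definition ucont f := forall e : R, 0 < e -> exists2 d : R, 0 < d &
  forall k k' : pt, cube R N k -> cube R N k' ->
    (forall i, `|tnth k i - tnth k' i| < d) -> `|f k - f k'| < e.

Definition pcont f := forall k : pt, cube R N k -> forall e : R, 0 < e ->
  exists2 d : R, 0 < d & forall k' : pt, cube R N k' ->
    (forall i, `|tnth k i - tnth k' i| < d) -> `|f k - f k'| < e.

Lemma ucont_pcont f : ucont f -> pcont f.
Proof.
by move=> uf k ck e e0; have [d d0 h] := uf e e0; exists d => // k'; exact: h.
Qed.

Let K := [set v : 'rV[R]_N | forall i, 0 <= v ord0 i <= 1].

Let compactK : compact K.
Proof.
have := @rV_compact R N (fun=> `[0, 1]%classic) (fun=> @segment_compact R 0 1).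
by congr (compact _); apply/seteqP; split => v h i; have := h i; rewrite /= in_itv.
Qed.

Let tup (v : 'rV[R]_N) : pt := [tuple v ord0 i | i < N].
Let row (k : pt) : 'rV[R]_N := \row_i tnth k i.

Let rowK k : tup (row k) = k.
Proof. by apply: eq_from_tnth => i; rewrite tnth_mktuple mxE. Qed.

Let cube_tup v : K v -> cube R N (tup v).
Proof. by move=> h i; rewrite tnth_mktuple; exact: h. Qed.

Let K_row k : cube R N k -> K (row k).
Proof. by move=> h i; rewrite mxE; exact: h. Qed.

(** Heine-Cantor through the near-covering form of compactness. The parameter filter is [d] tending
    to 0 from the right: a property that holds locally in the point and for small [d] holds on all
    of [K] for a single [d]. *)
Lemma pcont_ucont f : pcont f -> ucont f.
Proof.
move=> pf e e0; have /compact_near_coveringP/near_covering_withinP := compactK.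
move=> /(_ R 0^'+ (fun d v => forall w, K w -> (forall i, `|v ord0 i - w ord0 i| < d) ->
  `|f (tup v) - f (tup w)| < e) _) h.
have [|d [hd d0]] := @filter_ex _ (0^'+ : set_system R) _
    (fun d => (K `<=` (fun v => forall w, K w ->
      (forall i, `|v ord0 i - w ord0 i| < d) -> `|f (tup v) - f (tup w)| < e)) /\ 0 < d).
- apply: filterI; last exact: nbhs_right_gt.
  apply: h => v Kv; have [d d0 hd] := pf _ (cube_tup Kv) (e / 2) (divr_gt0 e0 (ltr0n _ 2)).
  (* With half the radius for [v'] and half for the distance from [v'] to [w], both points stay
     within [d] of [v]. *)
  exists (ball v (d / 2), [set x : R | x < d / 2]); first split => /=.
  + by apply/nbhs_ballP; exists (d / 2) => //=; exact: divr_gt0.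
  + by apply: nbhs_right_lt; exact: divr_gt0.
  move=> [v' d'] /= [[_ vv'] d'd] Kv' w Kw v'w.
  have h1 : `|f (tup v) - f (tup v')| < e / 2.
    apply: hd; first exact: cube_tup.
    move=> i; rewrite !tnth_mktuple; have := vv' ord0 i; rewrite /ball/= => h1.
    by apply: lt_le_trans h1 _; lra.
  have h2 : `|f (tup v) - f (tup w)| < e / 2.
    apply: hd; first exact: cube_tup.
    move=> i; rewrite !tnth_mktuple; have := vv' ord0 i; rewrite /ball/= => h1'.
    have := v'w i; have := ler_distD (v' ord0 i) (v ord0 i) (w ord0 i); lra.
  have := ler_distD (f (tup v)) (f (tup v')) (f (tup w)).
  rewrite [`|f (tup v') - f (tup v)|]distrC; lra.
exists d => // k k' ck ck' kk'; rewrite -(rowK k) -(rowK k').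
by apply: hd; [exact: K_row|exact: K_row|move=> i; rewrite !mxE].
Qed.

(** The same covering argument, with the bound tending to infinity as the parameter. *)
Lemma ucont_bounded f : ucont f -> exists2 c : R, 0 <= c &
  forall k, cube R N k -> `|f k| <= c.
Proof.
move=> uf; have /compact_near_coveringP/near_covering_withinP := compactK.
move=> /(_ R +oo%R (fun c v => `|f (tup v)| <= c) _) h.
have [|c [hc c0]] := @filter_ex _ (+oo%R : set_system R) _
    (fun c => (K `<=` (fun v => `|f (tup v)| <= c)) /\ 0 <= c).
- apply: filterI; last exact: nbhs_pinfty_ge.
  apply: h => v Kv; have [d d0 hd] := uf 1 ltr01.
  exists (ball v d, [set x : R | `|f (tup v)| + 1 <= x]); first split => /=.
  + by apply/nbhs_ballP; exists d.
  + by apply: nbhs_pinfty_ge; rewrite num_real.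
  move=> [v' c] /= [[_ vv'] hc] Kv'.
  have h1 : `|f (tup v) - f (tup v')| < 1.
    apply: hd; [exact: cube_tup|exact: cube_tup|].
    by move=> i; rewrite !tnth_mktuple; exact: vv'.
  have := ler_normB (f (tup v)) (f (tup v) - f (tup v')).
  by rewrite opprB addrC subrK; lra.
by exists c => // k ck; rewrite -(rowK k); apply: hc; exact: K_row.
Qed.

Lemma continuous_on_cube_pcont p q (F : pt -> 'M[R[i]]_(p, q)) a b :
  continuous_on_cube F ->
  pcont (fun k => complex.Re (F k a b)) /\ pcont (fun k => complex.Im (F k a b)).
Proof.
move=> /subspace_continuousP cF.
suff h k (ck : cube R N k) (e : R) (e0 : 0 < e) : exists2 d : R, 0 < d &
    forall k' : pt, cube R N k' -> (forall i, `|tnth k i - tnth k' i| < d) ->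
    `|complex.Re (F k a b) - complex.Re (F k' a b)| < e /\
    `|complex.Im (F k a b) - complex.Im (F k' a b)| < e.
  split => k ck e e0; have [d d0 hd] := h k ck e e0; exists d => // k' ck' kk'.
    by have [] := hd k' ck' kk'.
  by have [] := hd k' ck' kk'.
have /cvg_ballP := cF _ (K_row ck).
have ec0 : 0 < (e%:C)%C :> R[i] by rewrite ltcR.
move=> /(_ _ ec0); rewrite near_withinE => /nbhs_ballP[d /= d0 hd].
exists d => // k' ck' kk'.
have : ball (row k) d (row k') by split => // i j; rewrite !mxE; exact: kk'.
move=> /hd /(_ (K_row ck')) [_ /(_ a b) h].
have {h} : `|F (tup (row k)) a b - F (tup (row k')) a b| < (e%:C)%C by exact: h.
rewrite !rowK normc_def ltcR => h.
move: (F k a b) (F k' a b) h => [x1 y1] [x2 y2] /= h.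
split; apply: le_lt_trans h; rewrite -sqrtr_sqr; apply: ler_wsqrtr.
  by rewrite lerDl sqr_ge0.
by rewrite lerDr sqr_ge0.
Qed.

Lemma eq_ucont f g : (forall k, cube R N k -> f k = g k) -> ucont f -> ucont g.
Proof.
move=> fg uf e e0; have [d d0 hd] := uf e e0; exists d => // k k' ck ck' kk'.
by rewrite -!fg//; exact: hd.
Qed.

Lemma ucont_cst (c : R) : ucont (fun=> c).
Proof. by move=> e e0; exists 1 => // k k' *; rewrite subrr normr0. Qed.

Lemma ucontD f g : ucont f -> ucont g -> ucont (fun k => f k + g k).
Proof.
move=> uf ug e e0; have e20 : 0 < e / 2 by apply: divr_gt0.
have [d d0 hd] := uf _ e20; have [d' d'0 hd'] := ug _ e20.
exists (Num.min d d'); first by rewrite lt_min d0.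
move=> k k' ck ck' kk'.
have h1 : `|f k - f k'| < e / 2.
  by apply: hd => // i; have := kk' i; rewrite lt_min => /andP[].
have h2 : `|g k - g k'| < e / 2.
  by apply: hd' => // i; have := kk' i; rewrite lt_min => /andP[].
rewrite (_ : _ - _ = (f k - f k') + (g k - g k')); last ring.
by have := ler_normD (f k - f k') (g k - g k'); lra.
Qed.

Lemma ucontM f g : ucont f -> ucont g -> ucont (fun k => f k * g k).
Proof.
move=> uf ug e e0.
have [a a0 ha] := ucont_bounded uf; have [b b0 hb] := ucont_bounded ug.
(* The [+ 1] keeps the denominators positive when a bound is 0, and makes both halves of the
   estimate strict. *)
have ea0 : 0 < e / (2 * (b + 1)) by apply: divr_gt0 => //; lra.
have eb0 : 0 < e / (2 * (a + 1)) by apply: divr_gt0 => //; lra.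
have [d d0 hd] := uf _ ea0; have [d' d'0 hd'] := ug _ eb0.
exists (Num.min d d'); first by rewrite lt_min d0.
move=> k k' ck ck' kk'.
have h1 : `|f k - f k'| < e / (2 * (b + 1)).
  by apply: hd => // i; have := kk' i; rewrite lt_min => /andP[].
have h2 : `|g k - g k'| < e / (2 * (a + 1)).
  by apply: hd' => // i; have := kk' i; rewrite lt_min => /andP[].
rewrite (_ : _ - _ = (f k - f k') * g k + f k' * (g k - g k')); last ring.
apply: le_lt_trans (ler_normD _ _) _; rewrite !normrM.
have h3 : `|f k - f k'| * `|g k| <= e / (2 * (b + 1)) * b.
  by apply: ler_pM => //; [exact: ltW|exact: hb].
have h4 : `|f k'| * `|g k - g k'| <= a * (e / (2 * (a + 1))).
  by apply: ler_pM => //; [exact: ha|exact: ltW].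
have -> : e = e / 2 + e / 2 by lra.
have h5 : e / (2 * (b + 1)) * b < e / 2.
  rewrite -subr_gt0 (_ : _ - _ = e / (2 * (b + 1))) //; field; lra.
have h6 : a * (e / (2 * (a + 1))) < e / 2.
  rewrite -subr_gt0 (_ : _ - _ = e / (2 * (a + 1))) //; field; lra.
lra.
Qed.

Lemma ucontN f : ucont f -> ucont (fun k => - f k).
Proof.
move=> uf; apply: (@eq_ucont (fun k => -1 * f k)); first by move=> k _; rewrite mulN1r.
by apply: ucontM => //; exact: ucont_cst.
Qed.

Lemma ucont_sum (I : Type) (r : seq I) (F : I -> pt -> R) :
  (forall i, ucont (F i)) -> ucont (fun k => \sum_(i <- r) F i k).
Proof.
move=> uF; elim: r => [|i r IH].
  by apply: (eq_ucont _ (ucont_cst 0)) => k _; rewrite big_nil.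
by apply: (eq_ucont _ (ucontD (uF i) IH)) => k _; rewrite big_cons.
Qed.

(** Compactness upgrades pointwise continuity, so a lower bound on [|f|] near each point is
    enough. *)
Lemma ucontV f : (forall k, cube R N k -> f k != 0) -> ucont f ->
  ucont (fun k => (f k)^-1).
Proof.
move=> fn0 /ucont_pcont pf; apply: pcont_ucont => k ck e e0.
have fk0 : 0 < `|f k| by rewrite normr_gt0 fn0.
(* The first term forces $|f(k')| > |f(k)|/2$; the second then bounds $|f(k) - f(k')| / |f(k)
   f(k')|$ by [e]. *)
have m0 : 0 < Num.min (`|f k| / 2) (e * `|f k| ^+ 2 / 2).
  by rewrite lt_min !divr_gt0// mulr_gt0// exprn_gt0.
have [d d0 hd] := pf k ck _ m0; exists d => // k' ck' kk'.
have := hd k' ck' kk'; rewrite lt_min => /andP[h1 h2].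
have h3 : `|f k| / 2 < `|f k'|.
  by have := ler_distD (f k') (f k) 0; rewrite !subr0; lra.
rewrite (_ : _ - _ = - ((f k - f k') / (f k * f k'))); last first.
  by field; rewrite !fn0.
rewrite normrN normrM normfV normrM ltr_pdivrMr; last first.
  by rewrite mulr_gt0// (lt_trans _ h3)// divr_gt0.
apply: lt_le_trans h2 _.
rewrite (_ : e * _ / 2 = e * (`|f k| * (`|f k| / 2))); last by field.
by rewrite ler_pM2l// ler_pM2l// ltW.
Qed.

(** On the cube, [f] is the pointwise limit of step functions on a grid of half-open cells of side
    $1/(n+1)$, which are measurable for the product sigma-algebra. *)
Lemma ucont_measurable f : ucont f -> measurable_fun (cube R N) f.
Proof.
move=> uf.
pose c n : R := n.+1%:R.
(* The index takes [n.+2] values because a coordinate equal to 1 falls into cell number $n+1$. *)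
pose pnt n (p : {ffun 'I_N -> 'I_n.+2}) : pt := [tuple (p i)%:R / c n | i < N].
pose B n (p : {ffun 'I_N -> 'I_n.+2}) : set pt :=
  [set k : pt | forall i, (p i)%:R <= c n * tnth k i < (p i).+1%:R].
have c0 n : 0 < c n by rewrite ltr0n.
have mB n p : measurable (B n p).
  rewrite (_ : B n p = \bigcap_(i in [set: 'I_N])
      ((@tnth _ (measurableTypeR R) ^~ i) @^-1` [set` `[(p i)%:R / c n, (p i).+1%:R / c n[])).
    apply: fin_bigcap_measurable => // i _.
    by rewrite -[X in measurable X]setTI; apply: measurable_tnth.
  apply/seteqP; split => k h i; [move=> _; have := h i|have := h i I];
    by rewrite /= in_itv/= ler_pdivrMr// ltr_pdivlMr// mulrC.
apply: (@measurable_fun_cvg _ _ _ _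
  (fun n k => \sum_(p : {ffun 'I_N -> 'I_n.+2}) f (pnt n p) * \1_(B n p) k)).
  move=> n; apply: measurable_sum => p; apply: measurable_funM.
    exact: measurable_cst.
  exact: measurable_indic.
move=> k ck; apply/cvgrPdist_lt => e e0.
have [d d0 hd] := uf e e0.
have := near_infty_natSinv_lt (PosNum d0); apply: filterS => n /= nd.
pose p : {ffun 'I_N -> 'I_n.+2} := [ffun i => inord (Num.trunc (c n * tnth k i))].
have pE i : p i = Num.trunc (c n * tnth k i) :> nat.
  rewrite ffunE inordK// ltnS.
  have /andP[k0 k1] := ck i.
  have /andP[h _] := trunc_itv (mulr_ge0 (ltW (c0 n)) k0).
  rewrite -(ler_nat R); apply: le_trans h _.
  by rewrite -[leRHS]mulr1 ler_pM2l.
have Bp : B n p k.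
  move=> i; rewrite pE; apply: trunc_itv; apply: mulr_ge0; first exact: ltW.
  by have /andP[] := ck i.
(* The cells are disjoint, so only the one containing [k] contributes to the sum. *)
rewrite (bigD1 p)//= (@big1 _ _ _ _ _ (fun i => i != p)) ?addr0; last first.
  move=> p' p'p; rewrite indicE memNset ?mulr0// => Bp'.
  move/eqP: p'p; apply; apply/ffunP => i; apply/val_inj; rewrite /= pE.
  by have /trunc_def := Bp' i.
rewrite indicE mem_set// mulr1; apply: hd => //.
  move=> i; rewrite tnth_mktuple divr_ge0//= ler_pdivrMr// mul1r ler_nat.
  by rewrite -ltnS.
move=> i; rewrite tnth_mktuple.
have /andP[h1 h2] := Bp i.
apply: le_lt_trans nd; rewrite -(ler_pM2l (c0 n)) divff ?gt_eqF//.
rewrite -{1}(gtr0_norm (c0 n)) -normrM mulrBr mulrCA divff ?gt_eqF// mulr1.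
by rewrite ger0_norm ?subr_ge0// lerBlDl natr1 ltW.
Qed.

End UniformContinuity.

(** * Complex averages *)

Section ComplexParts.
Context {R : realType}.
Local Notation C := R[i].
Implicit Types (z w : C).

Lemma complexReD z w : complex.Re (z + w) = complex.Re z + complex.Re w.
Proof. by case: z w => ? ? []. Qed.

Lemma complexImD z w : complex.Im (z + w) = complex.Im z + complex.Im w.
Proof. by case: z w => ? ? []. Qed.

Lemma complexReM z w : complex.Re (z * w) =
  complex.Re z * complex.Re w - complex.Im z * complex.Im w.
Proof. by case: z w => ? ? []. Qed.

Lemma complexImM z w : complex.Im (z * w) =
  complex.Re z * complex.Im w + complex.Im z * complex.Re w.
Proof. by case: z w => ? ? []. Qed.

Lemma complexRe_sum (I : Type) (r : seq I) (F : I -> C) :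
  complex.Re (\sum_(i <- r) F i) = \sum_(i <- r) complex.Re (F i).
Proof. exact: (big_morph _ complexReD erefl). Qed.

Lemma complexIm_sum (I : Type) (r : seq I) (F : I -> C) :
  complex.Im (\sum_(i <- r) F i) = \sum_(i <- r) complex.Im (F i).
Proof. exact: (big_morph _ complexImD erefl). Qed.

Lemma complex_ext z w : complex.Re z = complex.Re w ->
  complex.Im z = complex.Im w -> z = w.
Proof. by case: z w => ? ? [] ? ? /= -> ->. Qed.

End ComplexParts.

Section ComplexIntegral.
Context {R : realType} {n : nat}.
Local Notation C := R[i].
Local Notation mu := (lebesgue n).
Implicit Types (f g : Rpoint R n -> C).

Definition cintegrable f :=
  mu.-integrable (cube R n) (fun x => (complex.Re (f x))%:E) /\
  mu.-integrable (cube R n) (fun x => (complex.Im (f x))%:E).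

Let intD (f g : Rpoint R n -> R) :
  mu.-integrable (cube R n) (fun x => (f x)%:E) ->
  mu.-integrable (cube R n) (fun x => (g x)%:E) ->
  mu.-integrable (cube R n) (fun x => (f x + g x)%:E).
Proof. by move=> i1 i2; exact: (integrableD (measurable_cube (n := n)) i1 i2). Qed.

Let intZ (c : R) (f : Rpoint R n -> R) :
  mu.-integrable (cube R n) (fun x => (f x)%:E) ->
  mu.-integrable (cube R n) (fun x => (c * f x)%:E).
Proof. by move=> i1; under eq_fun do rewrite EFinM; exact: integrableZl. Qed.

Lemma cintegrableD f g : cintegrable f -> cintegrable g ->
  cintegrable (fun x => f x + g x).
Proof.
move=> [f1 f2] [g1 g2]; split.
- by under eq_fun do rewrite complexReD; exact: intD.
- by under eq_fun do rewrite complexImD; exact: intD.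
Qed.

Lemma cintegralD f g : cintegrable f -> cintegrable g ->
  cintegral (cube R n) (fun x => f x + g x) =
  cintegral (cube R n) f + cintegral (cube R n) g.
Proof.
move=> [f1 f2] [g1 g2]; apply: complex_ext; rewrite ?complexReD ?complexImD /=.
- by under eq_Rintegral do rewrite complexReD; rewrite RintegralD.
- by under eq_Rintegral do rewrite complexImD; rewrite RintegralD.
Qed.

Lemma cintegrableZ (c : C) f : cintegrable f -> cintegrable (fun x => c * f x).
Proof.
move=> [f1 f2]; split.
- under eq_fun do rewrite complexReM -mulNr.
  by apply: intD; exact: intZ.
- under eq_fun do rewrite complexImM.
  by apply: intD; exact: intZ.
Qed.

Lemma cintegralZ (c : C) f : cintegrable f ->
  cintegral (cube R n) (fun x => c * f x) = c * cintegral (cube R n) f.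
Proof.
move=> [f1 f2]; apply: complex_ext; rewrite ?complexReM ?complexImM /=.
- under eq_Rintegral do rewrite complexReM -mulNr.
  by rewrite RintegralD ?RintegralZl ?mulNr//; exact: intZ.
- under eq_Rintegral do rewrite complexImM.
  by rewrite RintegralD ?RintegralZl//; exact: intZ.
Qed.

Lemma cintegrable0 : cintegrable (fun=> 0).
Proof. by split; exact: integrable0. Qed.

Lemma cintegral0 : cintegral (cube R n) (fun=> 0) = 0 :> C.
Proof.
by apply: complex_ext => /=; rewrite /Rintegral integral0_eq.
Qed.

Lemma cintegrable_sum (I : Type) (r : seq I) (F : I -> Rpoint R n -> C) :
  (forall i, cintegrable (F i)) -> cintegrable (fun x => \sum_(i <- r) F i x).
Proof.
move=> iF; elim: r => [|i r IH]; first by under eq_fun do rewrite big_nil; exact: cintegrable0.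
by under eq_fun do rewrite big_cons; exact: cintegrableD.
Qed.

Lemma cintegral_sum (I : Type) (r : seq I) (F : I -> Rpoint R n -> C) :
  (forall i, cintegrable (F i)) ->
  cintegral (cube R n) (fun x => \sum_(i <- r) F i x) =
  \sum_(i <- r) cintegral (cube R n) (F i).
Proof.
move=> iF; elim: r => [|i r IH].
  by rewrite big_nil -[RHS]cintegral0; congr cintegral; apply/funext => x; rewrite big_nil.
rewrite big_cons -IH -cintegralD//; last exact: cintegrable_sum.
by congr cintegral; apply/funext => x; rewrite big_cons.
Qed.

End ComplexIntegral.

(** * Algebra of matrix averages at a fixed point *)

Section Splice.
Context {R : realType} {N : nat}.
Local Notation C := R[i].
Local Notation pt := (Rpoint R N).

Lemma splice_splice i j (y : Rpoint R i) (x : Rpoint R j) (k : pt) : (j <= i)%N ->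
  splice y (splice x k) = splice y k.
Proof.
move=> ji; apply: eq_from_tnth => l; rewrite !tnth_mktuple; case: ltnP => // il.
by rewrite ltnNge (leq_trans ji il).
Qed.

(** Independence of $k_1, \dots, k_j$ is expressed throughout as invariance under splicing a point
    of [Rpoint R j]. Averages over at least [j] coordinates have it, which is what lets them leave
    $\langle\cdot\rangle_j$. *)
Lemma avg_splice p q i j (F : pt -> 'M[C]_(p, q)) (x : Rpoint R j) (k : pt) :
  (j <= i)%N -> avg i F (splice x k) = avg i F k.
Proof.
move=> ji; apply/matrixP => a b; rewrite !mxE; congr cintegral.
by apply/funext => y; rewrite splice_splice.
Qed.

Lemma avg0 p q (F : pt -> 'M[C]_(p, q)) k : avg 0 F k = F k.
Proof.
apply/matrixP => a b; rewrite mxE /cintegral /Rintegral.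
by rewrite !integral_cube0 /= splice0; case: (F k a b).
Qed.

(** Integrability is attached to one point [k]: a continuous function has it at every point of the
    cube, an L^2 function only at almost every point. *)
Definition avgable p q j (F : pt -> 'M[C]_(p, q)) (k : pt) :=
  forall a b, cintegrable (fun x : Rpoint R j => F (splice x k) a b).

Lemma avgableD p q j (F G : pt -> 'M[C]_(p, q)) k :
  avgable j F k -> avgable j G k -> avgable j (fun k => F k + G k) k.
Proof.
by move=> iF iG a b; under eq_fun do rewrite mxE; exact: cintegrableD.
Qed.

Lemma avgD p q j (F G : pt -> 'M[C]_(p, q)) k :
  avgable j F k -> avgable j G k ->
  avg j (fun k => F k + G k) k = avg j F k + avg j G k.
Proof.
move=> iF iG; apply/matrixP => a b; rewrite !mxE -cintegralD//.
by congr cintegral; apply/funext => x; rewrite mxE.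
Qed.

Lemma avgableZ p q j (c : C) (F : pt -> 'M[C]_(p, q)) k :
  avgable j F k -> avgable j (fun k => c *: F k) k.
Proof.
by move=> iF a b; under eq_fun do rewrite mxE; exact: cintegrableZ.
Qed.

Lemma avgZ p q j (c : C) (F : pt -> 'M[C]_(p, q)) k :
  avgable j F k -> avg j (fun k => c *: F k) k = c *: avg j F k.
Proof.
move=> iF; apply/matrixP => a b; rewrite !mxE -cintegralZ//.
by congr cintegral; apply/funext => x; rewrite mxE.
Qed.

Lemma avgableMr p q r j (F : pt -> 'M[C]_(p, q)) (c : pt -> 'M[C]_(q, r)) k :
  (forall x : Rpoint R j, c (splice x k) = c k) ->
  avgable j F k -> avgable j (fun k => F k *m c k) k.
Proof.
move=> ck iF a b.
rewrite (_ : (fun _ => _) = fun x => \sum_s c k s b * F (splice x k) a s).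
  by apply: cintegrable_sum => s; exact: cintegrableZ.
apply/funext => x; rewrite mxE; apply: eq_bigr => s _.
by rewrite mulrC ck.
Qed.

Lemma avgMr p q r j (F : pt -> 'M[C]_(p, q)) (c : pt -> 'M[C]_(q, r)) k :
  (forall x : Rpoint R j, c (splice x k) = c k) ->
  avgable j F k -> avg j (fun k => F k *m c k) k = avg j F k *m c k.
Proof.
move=> ck iF; apply/matrixP => a b; rewrite !mxE.
rewrite (_ : (fun _ => _) = fun x => \sum_s c k s b * F (splice x k) a s); last first.
  apply/funext => x; rewrite mxE; apply: eq_bigr => s _.
  by rewrite mulrC ck.
rewrite cintegral_sum; last by move=> s; exact: cintegrableZ.
by apply: eq_bigr => s _; rewrite cintegralZ// !mxE mulrC.
Qed.

Lemma avgable0 p q j k : avgable j (fun _ : pt => 0 : 'M[C]_(p, q)) k.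
Proof. by move=> a b; under eq_fun do rewrite mxE; exact: cintegrable0. Qed.

Lemma avg_zero p q j k : avg j (fun _ : pt => 0 : 'M[C]_(p, q)) k = 0.
Proof.
apply/matrixP => a b; rewrite !mxE -[RHS](@cintegral0 R j).
by congr cintegral; apply/funext => x; rewrite mxE.
Qed.

Lemma avgable_sum p q j (I : Type) (r : seq I) (P : pred I)
    (F : I -> pt -> 'M[C]_(p, q)) k :
  (forall i, P i -> avgable j (F i) k) ->
  avgable j (fun k => \sum_(i <- r | P i) F i k) k.
Proof.
move=> iF; elim: r => [|i r IH].
  by under eq_fun do rewrite big_nil; exact: avgable0.
under eq_fun do rewrite big_cons; case: (boolP (P i)) => //= Pi.
exact: (avgableD (iF i Pi) IH).
Qed.

Lemma avg_sum p q j (I : Type) (r : seq I) (P : pred I)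
    (F : I -> pt -> 'M[C]_(p, q)) k :
  (forall i, P i -> avgable j (F i) k) ->
  avg j (fun k => \sum_(i <- r | P i) F i k) k = \sum_(i <- r | P i) avg j (F i) k.
Proof.
move=> iF; elim: r => [|i r IH].
  by under eq_fun do rewrite big_nil; rewrite big_nil avg_zero.
under eq_fun do rewrite big_cons; rewrite big_cons; case: (boolP (P i)) => //= Pi.
by rewrite avgD ?IH//; [exact: iF|exact: avgable_sum].
Qed.

End Splice.

(** * Continuity of matrix functions, their inverses and their averages *)

Section MatrixContinuity.
Context {R : realType} {N : nat}.
Local Notation C := R[i].
Local Notation pt := (Rpoint R N).

Definition cucont (f : pt -> C) :=
  ucont (fun k => complex.Re (f k)) /\ ucont (fun k => complex.Im (f k)).

Lemma eq_cucont (f g : pt -> C) : (forall k, cube R N k -> f k = g k) ->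
  cucont f -> cucont g.
Proof.
by move=> fg [h1 h2]; split; [apply: eq_ucont h1|apply: eq_ucont h2] => k ck; rewrite fg.
Qed.

Lemma cucont_cst (c : C) : cucont (fun=> c).
Proof. by split; exact: ucont_cst. Qed.

Lemma cucontD (f g : pt -> C) : cucont f -> cucont g -> cucont (fun k => f k + g k).
Proof.
move=> [f1 f2] [g1 g2]; split.
- by apply: eq_ucont (ucontD f1 g1) => k _; rewrite complexReD.
- by apply: eq_ucont (ucontD f2 g2) => k _; rewrite complexImD.
Qed.

Lemma cucontM (f g : pt -> C) : cucont f -> cucont g -> cucont (fun k => f k * g k).
Proof.
move=> [f1 f2] [g1 g2]; split.
- apply: eq_ucont (ucontD (ucontM f1 g1) (ucontN (ucontM f2 g2))) => k _.
  by rewrite complexReM.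
- by apply: eq_ucont (ucontD (ucontM f1 g2) (ucontM f2 g1)) => k _; rewrite complexImM.
Qed.

Lemma cucont_sum (I : Type) (r : seq I) (F : I -> pt -> C) :
  (forall i, cucont (F i)) -> cucont (fun k => \sum_(i <- r) F i k).
Proof.
move=> uF; elim: r => [|i r IH].
  by apply: (eq_cucont _ (cucont_cst 0)) => k _; rewrite big_nil.
by apply: (eq_cucont _ (cucontD (uF i) IH)) => k _; rewrite big_cons.
Qed.

Lemma cucont_prod (I : Type) (r : seq I) (F : I -> pt -> C) :
  (forall i, cucont (F i)) -> cucont (fun k => \prod_(i <- r) F i k).
Proof.
move=> uF; elim: r => [|i r IH].
  by apply: (eq_cucont _ (cucont_cst 1)) => k _; rewrite big_nil.
by apply: (eq_cucont _ (cucontM (uF i) IH)) => k _; rewrite big_cons.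
Qed.

Lemma cucontV (f : pt -> C) : (forall k, cube R N k -> f k != 0) -> cucont f ->
  cucont (fun k => (f k)^-1).
Proof.
move=> fn0 [f1 f2].
(* [n] is the squared modulus, and the inverse of a complex number is its conjugate divided by
   it. *)
pose n k := complex.Re (f k) * complex.Re (f k) + complex.Im (f k) * complex.Im (f k).
have un : ucont (fun k => (n k)^-1).
  apply: ucontV; last by apply: ucontD; exact: ucontM.
  move=> k ck; have := fn0 k ck; rewrite /n; case: (f k) => x y /=.
  rewrite eq_complex /= negb_and => /orP[h|h].
    by rewrite gt_eqF// ltr_pwDl// -?expr2 ?sqr_ge0// exprn_even_gt0.
  by rewrite gt_eqF// ltr_pwDr// -?expr2 ?sqr_ge0// exprn_even_gt0.
split.
- apply: eq_ucont (ucontM f1 un) => k _.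
  by rewrite /n -!expr2; case: (f k).
- apply: eq_ucont (ucontN (ucontM f2 un)) => k _.
  by rewrite /n -!expr2; case: (f k).
Qed.

Definition mcont p q (F : pt -> 'M[C]_(p, q)) := forall a b, cucont (fun k => F k a b).

Lemma continuous_on_cube_mcont p q (F : pt -> 'M[C]_(p, q)) :
  continuous_on_cube F -> mcont F.
Proof.
move=> cF a b; have [h1 h2] := continuous_on_cube_pcont a b cF.
by split; exact: pcont_ucont.
Qed.

Lemma mcont_cst p q (F : 'M[C]_(p, q)) : mcont (fun=> F).
Proof. by move=> a b; exact: cucont_cst. Qed.

Lemma mcontD p q (F G : pt -> 'M[C]_(p, q)) : mcont F -> mcont G ->
  mcont (fun k => F k + G k).
Proof. by move=> uF uG a b; apply: eq_cucont (cucontD (uF a b) (uG a b)) => k _; rewrite mxE. Qed.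

Lemma mcontM p q r (F : pt -> 'M[C]_(p, q)) (G : pt -> 'M[C]_(q, r)) :
  mcont F -> mcont G -> mcont (fun k => F k *m G k).
Proof.
move=> uF uG a b.
apply: (@eq_cucont (fun k => \sum_s F k a s * G k s b)).
  by move=> k _; rewrite mxE.
by apply: cucont_sum => s; exact: cucontM.
Qed.

Lemma mcontN p q (F : pt -> 'M[C]_(p, q)) : mcont F -> mcont (fun k => - F k).
Proof.
move=> uF a b; apply: eq_cucont (cucontM (cucont_cst (-1)) (uF a b)) => k _.
by rewrite mxE mulN1r.
Qed.

Lemma cucont_det n (F : pt -> 'M[C]_n) : mcont F -> cucont (fun k => \det (F k)).
Proof.
move=> uF; apply: cucont_sum => s; apply: cucontM; first exact: cucont_cst.
by apply: cucont_prod => i; exact: uF.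
Qed.

(** By the adjugate formula, the entries of the inverse are cofactors divided by the determinant. *)
Lemma mcont_invmx n (F : pt -> 'M[C]_n) : (forall k, cube R N k -> F k \in unitmx) ->
  mcont F -> mcont (fun k => invmx (F k)).
Proof.
move=> Fu uF a b.
apply: (@eq_cucont (fun k => (\det (F k))^-1 * cofactor (F k) b a)).
  by move=> k ck; rewrite /invmx (Fu k ck) !mxE.
apply: cucontM.
  apply: cucontV; last exact: cucont_det.
  by move=> k ck; rewrite -unitfE; have := Fu k ck; rewrite unitmxE.
apply: cucontM; first exact: cucont_cst.
apply: cucont_det => a' b'; apply: eq_cucont (uF (lift b a') (lift a b')) => k _.
by rewrite !mxE.
Qed.

Lemma ucont_splice_integrable j (f : pt -> R) k : ucont f -> cube R N k ->
  (lebesgue j).-integrable (cube R j) (fun x => (f (splice x k))%:E).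
Proof.
move=> uf ck; have [c c0 hc] := ucont_bounded uf.
apply: (prob_bounded_integrable (measurable_cube (n := j)) (lebesgue_cube j) (c := c)).
  exact: measurable_splice_section (ucont_measurable uf).
by move=> x cx; apply: hc; exact: cube_splice.
Qed.

Lemma mcont_avgable p q j (F : pt -> 'M[C]_(p, q)) k : mcont F -> cube R N k ->
  avgable j F k.
Proof.
move=> uF ck a b; have [h1 h2] := uF a b; split.
- exact: (ucont_splice_integrable j h1 ck).
- exact: (ucont_splice_integrable j h2 ck).
Qed.

(** Splicing the same [x] into [k] and [k'] does not increase any coordinate difference, so the
    modulus of continuity of [f] serves for its average. It is taken at [e / 2] because integration
    yields only a weak inequality. *)
Lemma ucont_ravg j (f : pt -> R) : ucont f -> ucont (ravg j f).
Proof.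
move=> uf e e0; have [d d0 hd] := uf (e / 2) (divr_gt0 e0 (ltr0n _ 2)).
exists d => // k k' ck ck' kk'.
have i1 := ucont_splice_integrable j uf ck.
have i2 := ucont_splice_integrable j uf ck'.
have i3 : (lebesgue j).-integrable (cube R j)
   (fun x => (f (splice x k) - f (splice x k'))%:E).
  exact: (integrableB (measurable_cube (n := j)) i1 i2).
rewrite /ravg -RintegralB//; apply: (@le_lt_trans _ _ (e / 2)); last lra.
apply: le_trans (le_normr_Rintegral _ _) _ => //.
have mu1 := @lebesgue_cube R j.
rewrite -[leRHS](prob_Rintegral_cst (measurable_cube (n := j)) mu1).
apply: le_Rintegral => //.
- exact: (integrable_abse i3).
- exact: (prob_integrable_cst (measurable_cube (n := j)) mu1).
- move=> x cx; apply/ltW/hd; [exact: cube_splice|exact: cube_splice|].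
  move=> i; rewrite !tnth_mktuple; case: ltnP => // _.
  by rewrite subrr normr0.
Qed.

Lemma mcont_avg p q j (F : pt -> 'M[C]_(p, q)) : mcont F -> mcont (avg j F).
Proof.
move=> uF a b; have [h1 h2] := uF a b; split.
- by apply: eq_ucont (ucont_ravg j h1) => k _; rewrite mxE.
- by apply: eq_ucont (ucont_ravg j h2) => k _; rewrite mxE.
Qed.

End MatrixContinuity.

(** * Bounded linear operators on L^2 *)

Section Sqnorm.
Context {R : realType}.
Local Notation C := R[i].

Lemma sqnorm_ge0 p (w : 'cV[C]_p) : 0 <= sqnorm w.
Proof. by apply: sumr_ge0 => i _; rewrite addr_ge0 ?sqr_ge0. Qed.

Lemma sqnorm0 p : sqnorm (0 : 'cV[C]_p) = 0.
Proof. by apply: big1 => i _; rewrite mxE /= expr0n addr0. Qed.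

Lemma sqnorm_eq0 p (w : 'cV[C]_p) : sqnorm w = 0 -> w = 0.
Proof.
move=> /eqP; rewrite psumr_eq0 => [/allP h|i _]; last by rewrite addr_ge0 ?sqr_ge0.
apply/matrixP => i j; rewrite ord1 mxE.
have := h i (mem_index_enum i); rewrite paddr_eq0 ?sqr_ge0// !sqrf_eq0 => /andP[/eqP h1 /eqP h2].
exact: complex_ext.
Qed.

(** With squared norms and a factor 2 in place of the triangle inequality, all later estimates avoid
    square roots; only the finiteness of constants matters. *)
Lemma sqnormD_le p (u v : 'cV[C]_p) : sqnorm (u + v) <= 2 * sqnorm u + 2 * sqnorm v.
Proof.
rewrite /sqnorm !mulr_sumr -big_split/=; apply: ler_sum => i _.
rewrite mxE complexReD complexImD.
have h (x y : R) : (x + y) ^+ 2 <= 2 * x ^+ 2 + 2 * y ^+ 2.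
  rewrite -subr_ge0 (_ : _ - _ = (x - y) ^+ 2) ?sqr_ge0//; ring.
have := h (complex.Re (u i ord0)) (complex.Re (v i ord0)).
have := h (complex.Im (u i ord0)) (complex.Im (v i ord0)); lra.
Qed.

Lemma sqnormZ p (a : C) (u : 'cV[C]_p) :
  sqnorm (a *: u) = (complex.Re a ^+ 2 + complex.Im a ^+ 2) * sqnorm u.
Proof.
rewrite /sqnorm mulr_sumr; apply: eq_bigr => i _.
by rewrite mxE complexReM complexImM; ring.
Qed.

(** The crude power of 2 comes from iterating $(x+y)^2 \le 2x^2 + 2y^2$. *)
Lemma sqr_sum_le (I : Type) (r : seq I) (F : I -> R) :
  (\sum_(i <- r) F i) ^+ 2 <= 2 ^+ size r * \sum_(i <- r) F i ^+ 2.
Proof.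
elim: r => [|i r IH]; first by rewrite !big_nil expr0n mulr0.
rewrite !big_cons /= [2 ^+ _.+1]exprS; set S := \sum_(_ <- _) _ in IH *; set T := \sum_(_ <- _) _ in IH *.
have h : (F i + S) ^+ 2 <= 2 * F i ^+ 2 + 2 * S ^+ 2.
  rewrite -subr_ge0 (_ : _ - _ = (F i - S) ^+ 2) ?sqr_ge0//; ring.
have h1 : 1 <= 2 ^+ size r :> R by apply: exprn_ege1; lra.
have h2 := ler_peMl (sqr_ge0 (F i)) h1; lra.
Qed.

(** Cauchy-Schwarz in the plane gives $2c^2$ for each real or imaginary part of a product of
    entries, [sqr_sum_le] gives $2^q$ for a row, the two parts of a row give 2, and the [p] rows
    give [p]. *)
Lemma sqnorm_mulmx_le p q (F : 'M[C]_(p, q)) (u : 'cV[C]_q) (c : R) :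
  (forall a b, `|complex.Re (F a b)| <= c /\ `|complex.Im (F a b)| <= c) ->
  sqnorm (F *m u) <= (p%:R * (2 * (2 ^+ q * (2 * c ^+ 2)))) * sqnorm u.
Proof.
move=> hF; rewrite {1}/sqnorm.
have sz : size (index_enum 'I_q) = q by rewrite /index_enum -enumT size_enum_ord.
have part (G : 'I_q -> R) : (forall s, G s ^+ 2 <=
    (2 * c ^+ 2) * (complex.Re (u s ord0) ^+ 2 + complex.Im (u s ord0) ^+ 2)) ->
    (\sum_s G s) ^+ 2 <= 2 ^+ q * (2 * c ^+ 2) * sqnorm u.
  move=> hG; apply: le_trans (sqr_sum_le _ _) _.
  rewrite sz -mulrA ler_wpM2l ?exprn_ge0// /sqnorm mulr_sumr.
  by apply: ler_sum => s _; exact: hG.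
have sq (x : R) : `|x| <= c -> x ^+ 2 <= c ^+ 2.
  by move=> h; rewrite -(real_normK (num_real x)) lerXn2r ?nnegrE// (le_trans _ h).
have two (x y z w : R) : `|x| <= c -> `|y| <= c ->
    (x * z + y * w) ^+ 2 <= 2 * c ^+ 2 * (z ^+ 2 + w ^+ 2).
  move=> /sq hx /sq hy.
  have h : (x * z + y * w) ^+ 2 <= (x ^+ 2 + y ^+ 2) * (z ^+ 2 + w ^+ 2).
    rewrite -subr_ge0 (_ : _ - _ = (x * w - y * z) ^+ 2) ?sqr_ge0//; ring.
  apply: le_trans h _; rewrite ler_wpM2r ?addr_ge0 ?sqr_ge0//; lra.
rewrite -mulrA mulr_natl -[X in _ *+ X](card_ord p) -sumr_const; apply: ler_sum => a _.
rewrite mxE complexRe_sum complexIm_sum.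
have h1 : (\sum_s complex.Re (F a s * u s ord0)) ^+ 2 <= 2 ^+ q * (2 * c ^+ 2) * sqnorm u.
  apply: part => s; rewrite complexReM -mulNr.
  by have [h1 h2] := hF a s; apply: two; rewrite ?normrN.
have h2 : (\sum_s complex.Im (F a s * u s ord0)) ^+ 2 <= 2 ^+ q * (2 * c ^+ 2) * sqnorm u.
  apply: part => s; rewrite complexImM [X in _ <= _ * X]addrC.
  by have [? ?] := hF a s; apply: two.
lra.
Qed.

(** Matches the constants of [energyD_le] when both energies are bounded by multiples of the same
    quantity; nonnegativity secures distributivity in the extended reals. *)
Lemma ge0_double_muleDl (x y : R) (z : \bar R) : 0 <= x -> 0 <= y ->
  ((2 * x + 2 * y)%:E * z = 2%:E * (x%:E * z) + 2%:E * (y%:E * z))%E.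
Proof.
by move=> x0 y0; rewrite !muleA -!EFinM -ge0_muleDl// lee_fin; exact: mulr_ge0.
Qed.

End Sqnorm.

(** * Energy estimates and operators bounded in squared norm *)

Section Operators.
Context {R : realType} {N : nat}.
Local Notation C := R[i].
Local Notation pt := (Rpoint R N).
Local Notation fct p := (pt -> 'cV[C]_p).

Definition cmeas p (u : fct p) := forall i,
  measurable_fun (cube R N) (fun k => complex.Re (u k i ord0)) /\
  measurable_fun (cube R N) (fun k => complex.Im (u k i ord0)).

(** The squared L^2 norm, kept in the extended reals so that estimates carry no finiteness
    conditions. *)
Definition energy p (u : fct p) : \bar R :=
  (\int[lebesgue N]_(k in cube R N) (sqnorm (u k))%:E)%E.

Lemma energy_ge0 p (u : fct p) : (0 <= energy u)%E.
Proof. by apply: integral_ge0 => k _; rewrite lee_fin sqnorm_ge0. Qed.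
#[local] Hint Resolve energy_ge0 : core.

Lemma measurable_sqnorm p (u : fct p) : cmeas u ->
  measurable_fun (cube R N) (fun k => (sqnorm (u k))%:E).
Proof.
move=> mu; apply/measurable_EFinP; apply: measurable_sum => i.
by have [m1 m2] := mu i; apply: measurable_funD; exact: measurable_funX.
Qed.
#[local] Hint Resolve measurable_sqnorm : core.

Lemma energyE p (u : fct p) : cmeas u -> energy u = (\sum_(i < p)
  (\int[lebesgue N]_(k in cube R N) (complex.Re (u k i ord0) ^+ 2)%:E +
   \int[lebesgue N]_(k in cube R N) (complex.Im (u k i ord0) ^+ 2)%:E))%E.
Proof.
move=> mu; rewrite /energy.
under eq_integral do rewrite -sumEFin.
rewrite ge0_integral_sum//; last 2 first.
- move=> i; apply/measurable_EFinP.
  by have [m1 m2] := mu i; apply: measurable_funD; exact: measurable_funX.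
- by move=> i k _; rewrite lee_fin addr_ge0 ?sqr_ge0.
apply: eq_bigr => i _; have [m1 m2] := mu i.
under eq_integral do rewrite EFinD.
rewrite ge0_integralD// => [k _||k _|]; rewrite ?lee_fin ?sqr_ge0//.
- exact/measurable_EFinP/measurable_funX.
- exact/measurable_EFinP/measurable_funX.
Qed.

Lemma energy_le p q (u : fct p) (v : fct q) (c : R) : 0 <= c -> cmeas u -> cmeas v ->
  (forall k, cube R N k -> sqnorm (u k) <= c * sqnorm (v k)) ->
  (energy u <= c%:E * energy v)%E.
Proof.
move=> c0 mu mv uv; rewrite /energy -ge0_integralZl_EFin//; last first.
- exact: measurable_sqnorm.
- by move=> k _; rewrite lee_fin sqnorm_ge0.
apply: ge0_le_integral => //.
- by move=> k _; rewrite lee_fin sqnorm_ge0.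
- exact: measurable_sqnorm.
- by apply: measurable_funeM; exact: measurable_sqnorm.
Qed.

Lemma energyD_le p (u v : fct p) : cmeas u -> cmeas v ->
  (energy (fun k => u k + v k)%R <= 2%:E * energy u + 2%:E * energy v)%E.
Proof.
move=> mu mv.
have sq0 q (w : fct q) k : (0 <= (2%:E : \bar R) * (sqnorm (w k))%:E)%E.
  by rewrite mule_ge0// lee_fin ?sqnorm_ge0.
rewrite /energy -!ge0_integralZl_EFin//; try exact: measurable_sqnorm;
  try by move=> k _; rewrite lee_fin sqnorm_ge0.
rewrite -ge0_integralD//; try by apply: measurable_funeM; exact: measurable_sqnorm.
apply: ge0_le_integral => //.
- by move=> k _; rewrite lee_fin sqnorm_ge0.
- apply: measurable_sqnorm => i; have [m1 m2] := mu i; have [m3 m4] := mv i.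
  split.
    by under eq_fun do rewrite mxE complexReD; exact: measurable_funD.
  by under eq_fun do rewrite mxE complexImD; exact: measurable_funD.
- by apply: emeasurable_funD; apply: measurable_funeM; exact: measurable_sqnorm.
- by move=> k ck; rewrite -!EFinM -EFinD lee_fin sqnormD_le.
Qed.

Lemma cmeasD p (u v : fct p) : cmeas u -> cmeas v -> cmeas (fun k => u k + v k).
Proof.
move=> mu mv i; have [m1 m2] := mu i; have [m3 m4] := mv i; split.
  by under eq_fun do rewrite mxE complexReD; exact: measurable_funD.
by under eq_fun do rewrite mxE complexImD; exact: measurable_funD.
Qed.

Lemma cmeas_mul p q (F : pt -> 'M[C]_(p, q)) (u : fct q) : mcont F -> cmeas u ->
  cmeas (mul_op F u).
Proof.
move=> uF mu i; split.
- under eq_fun do rewrite mxE complexRe_sum.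
  apply: measurable_sum => s; under eq_fun do rewrite complexReM.
  have [f1 f2] := uF i s; have [m1 m2] := mu s.
  by apply: measurable_funB; apply: measurable_funM => //; exact: ucont_measurable.
- under eq_fun do rewrite mxE complexIm_sum.
  apply: measurable_sum => s; under eq_fun do rewrite complexImM.
  have [f1 f2] := uF i s; have [m1 m2] := mu s.
  by apply: measurable_funD; apply: measurable_funM => //; exact: ucont_measurable.
Qed.

Lemma cmeasZ p (a : C) (u : fct p) : cmeas u -> cmeas (fun k => a *: u k).
Proof.
move=> mu; have := cmeas_mul (@mcont_cst R N p p a%:M) mu.
by rewrite /mul_op; under eq_fun do rewrite mul_scalar_mx.
Qed.

Lemma cmeas_avg p j (u : fct p) : cmeas u -> cmeas (avg j u).
Proof.
move=> mu i; have [m1 m2] := mu i; split.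
- by under eq_fun do rewrite mxE; exact: (measurable_ravg j m1).
- by under eq_fun do rewrite mxE; exact: (measurable_ravg j m2).
Qed.

Lemma L2D p (u v : fct p) : L2 u -> L2 v -> L2 (fun k => u k + v k).
Proof.
move=> [mu eu] [mv ev]; split; first exact: cmeasD.
apply: le_lt_trans (energyD_le mu mv) _.
by rewrite lte_add_pinfty// lte_mul_pinfty// -?ge0_fin_numE.
Qed.

Lemma L2Z p (a : C) (u : fct p) : L2 u -> L2 (fun k => a *: u k).
Proof.
move=> [mu eu]; split; first exact: cmeasZ.
apply: (@le_lt_trans _ _ ((complex.Re a ^+ 2 + complex.Im a ^+ 2)%:E * energy u)%E).
  apply: energy_le => //; first by rewrite addr_ge0 ?sqr_ge0.
    exact: cmeasZ.
  by move=> k _; rewrite sqnormZ.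
by rewrite lte_mul_pinfty// lee_fin addr_ge0 ?sqr_ge0.
Qed.

Lemma energy_eq0 p (u : fct p) : cmeas u -> energy u = 0%E -> L2eq u (fun=> 0).
Proof.
move=> mu e0.
have : (\int[lebesgue N]_(k in cube R N) `|(sqnorm (u k))%:E| = 0)%E.
  by under eq_integral do rewrite gee0_abs ?lee_fin ?sqnorm_ge0//.
move=> /(ae_eq_integral_abs (lebesgue N) (@measurable_cube R N) (measurable_sqnorm mu)).
apply: filterS => k h ck; apply: sqnorm_eq0.
exact: (EFin_inj (h ck)).
Qed.

Lemma L2eq_energy p (u v : fct p) : cmeas u -> cmeas v -> L2eq u v -> energy u = energy v.
Proof.
move=> mu mv uv; apply: ae_eq_integral => //; try exact: measurable_sqnorm.
by apply: filterS uv => k h ck; rewrite h.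
Qed.

(** Source and target may have different dimensions, so that an averaging operator can be decomposed
    into multiplications and an average. Compatibility with almost everywhere equality is not a
    clause: [blin_eq] derives it. *)
Definition blin p q (Phi : fct q -> fct p) :=
  [/\ forall u, L2 u -> cmeas (Phi u),
      exists2 c : R, 0 <= c & forall u, L2 u -> (energy (Phi u) <= c%:E * energy u)%E
    & forall (a : C) u v, L2 u -> L2 v ->
        L2eq (Phi (fun k => a *: u k + v k)) (fun k => a *: Phi u k + Phi v k)].

Lemma L2eq_refl p (u : fct p) : L2eq u u.
Proof. exact: ae_eq_refl. Qed.

Lemma L2eq_trans p (u v w : fct p) : L2eq u v -> L2eq v w -> L2eq u w.
Proof. exact: ae_eq_trans. Qed.

Lemma blin_L2 p q (Phi : fct q -> fct p) u : blin Phi -> L2 u -> L2 (Phi u).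
Proof.
move=> [m [c c0 b] _] Lu; split; first exact: m.
apply: le_lt_trans (b u Lu) _; have [_ eu] := Lu.
by rewrite lte_mul_pinfty.
Qed.

(** The difference [w] has energy 0, the bound gives energy 0 to its image, and linearity identifies
    that image with the difference of the images. *)
Lemma blin_eq p q (Phi : fct q -> fct p) u v : blin Phi -> L2 u -> L2 v ->
  L2eq u v -> L2eq (Phi u) (Phi v).
Proof.
move=> bP Lu Lv uv; have [m [c c0 b] l] := bP.
pose w k := -1 *: u k + v k.
have Lw : L2 w by apply: L2D => //; exact: L2Z.
have w0 : L2eq w (fun=> 0).
  by apply: filterS uv => k h ck; rewrite /w h// scaleN1r addNr.
have cm0 : cmeas (fun _ : pt => 0 : 'cV[C]_q).
  by move=> i; split; under eq_fun do rewrite mxE; exact: measurable_cst.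
have ew0 : energy w = 0%E.
  rewrite (L2eq_energy _ _ w0)//; last by have [] := Lw.
  by rewrite /energy; under eq_integral do rewrite sqnorm0; rewrite integral0.
have ePw : energy (Phi w) = 0%E.
  by apply/eqP; rewrite eq_le energy_ge0 andbT; have := b w Lw; rewrite ew0 mule0.
have := energy_eq0 (m w Lw) ePw.
apply: filterS2 (l (-1) u v Lu Lv) => k h1 h2 ck.
have := h1 ck; rewrite -/(w) h2// scaleN1r => /esym/eqP.
by rewrite addrC subr_eq0 => /eqP.
Qed.

Lemma eq_blin p q (Phi Psi : fct q -> fct p) : (forall u k, Phi u k = Psi u k) ->
  blin Phi -> blin Psi.
Proof.
move=> e; rewrite (_ : Phi = Psi)//; apply/funext => u; apply/funext => k; exact: e.
Qed.

Lemma blin_comp p q r (Phi : fct q -> fct p) (Psi : fct r -> fct q) :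
  blin Phi -> blin Psi -> blin (Phi \o Psi).
Proof.
move=> bP bQ; have [m [c c0 b] l] := bP; have [m' [c' c'0 b'] l'] := bQ.
split => /=.
- by move=> u Lu; apply: m; exact: blin_L2.
- exists (c * c'); first exact: mulr_ge0.
  move=> u Lu; apply: le_trans (b _ (blin_L2 bQ Lu)) _.
  by rewrite EFinM -muleA lee_wpmul2l// b'.
- move=> a u v Lu Lv.
  apply: L2eq_trans (l a (Psi u) (Psi v) (blin_L2 bQ Lu) (blin_L2 bQ Lv)).
  apply: blin_eq => //; last exact: l'.
    by apply: blin_L2 => //; apply: L2D => //; exact: L2Z.
  by apply: L2D; [apply: L2Z|]; exact: blin_L2.
Qed.

Lemma blinD p q (Phi Psi : fct q -> fct p) : blin Phi -> blin Psi ->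
  blin (fun u k => Phi u k + Psi u k).
Proof.
move=> [m [c c0 b] l] [m' [c' c'0 b'] l']; split => /=.
- by move=> u Lu; apply: cmeasD; [exact: m|exact: m'].
- exists (2 * c + 2 * c'); first by rewrite addr_ge0// mulr_ge0.
  move=> u Lu; apply: le_trans (energyD_le (m u Lu) (m' u Lu)) _.
  by rewrite ge0_double_muleDl//; apply: leeD; rewrite lee_wpmul2l ?lee_fin ?b ?b'.
- move=> a u v Lu Lv; apply: filterS2 (l a u v Lu Lv) (l' a u v Lu Lv) => k h h' ck.
  by rewrite h// h'// scalerDr addrACA.
Qed.

Lemma blin_id p : blin (id : fct p -> fct p).
Proof.
split => /=; first by move=> u [].
- by exists 1 => // u _; rewrite mul1e.
- by move=> *; exact: L2eq_refl.
Qed.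

Lemma blin0 p q : blin (fun (_ : fct q) (_ : pt) => 0 : 'cV[C]_p).
Proof.
split => /=.
- by move=> u _ i; split; under eq_fun do rewrite mxE; exact: measurable_cst.
- exists 0 => // u _; rewrite mul0e /energy.
  by under eq_integral do rewrite sqnorm0; rewrite integral0.
- by move=> a u v _ _; apply: aeW => k _; rewrite scaler0 addr0.
Qed.

Lemma blin_sum p q (I : Type) (r : seq I) (P : pred I) (F : I -> fct q -> fct p) :
  (forall i, P i -> blin (F i)) -> blin (fun u k => \sum_(i <- r | P i) F i u k).
Proof.
move=> bF; elim: r => [|i r IH].
  by apply: eq_blin (blin0 p q) => u k; rewrite big_nil.
have [Pi|nPi] := boolP (P i).
  by apply: eq_blin (blinD (bF i Pi) IH) => u k; rewrite big_cons Pi.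
by apply: eq_blin IH => u k; rewrite big_cons (negbTE nPi).
Qed.

Lemma mcont_bounded p q (F : pt -> 'M[C]_(p, q)) : mcont F -> exists2 c : R, 0 <= c &
  forall k a b, cube R N k -> `|complex.Re (F k a b)| <= c /\ `|complex.Im (F k a b)| <= c.
Proof.
move=> uF.
have h (ab : 'I_p * 'I_q) : exists c : R, 0 <= c /\ forall k, cube R N k ->
   `|complex.Re (F k ab.1 ab.2)| <= c /\ `|complex.Im (F k ab.1 ab.2)| <= c.
  have [/ucont_bounded [c c0 h] /ucont_bounded [c' c'0 h']] := uF ab.1 ab.2.
  exists (c + c'); split; first exact: addr_ge0.
  by move=> k ck; have := h k ck; have := h' k ck; split; lra.
have [c hc] := choice h.
exists (\sum_ab c ab); first by apply: sumr_ge0 => ab _; have [] := hc ab.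
move=> k a b ck; have [_ /(_ k ck) /= [h1 h2]] := hc (a, b).
have le : c (a, b) <= \sum_ab c ab.
  rewrite (bigD1 (a, b))//= lerDl; apply: sumr_ge0 => ab _; by have [] := hc ab.
by split; apply: le_trans le.
Qed.

Lemma mcont_sqnorm_le p q (F : pt -> 'M[C]_(p, q)) : mcont F -> exists2 c : R, 0 <= c &
  forall k (u : 'cV[C]_q), cube R N k -> sqnorm (F k *m u) <= c * sqnorm u.
Proof.
move=> /mcont_bounded [c c0 h].
eexists; last first.
  by move=> k u ck; apply: (@sqnorm_mulmx_le R p q _ _ c) => a b; exact: h.
by rewrite !mulr_ge0// ?exprn_ge0// sqr_ge0.
Qed.

Lemma blin_mul p q (F : pt -> 'M[C]_(p, q)) : mcont F -> blin (mul_op F).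
Proof.
move=> uF; split.
- by move=> u [mu _]; exact: cmeas_mul.
- have [c c0 h] := mcont_sqnorm_le uF; exists c => // u [mu _].
  by apply: energy_le => //; [exact: cmeas_mul|move=> k ck; exact: h].
- move=> a u v _ _; apply: aeW => k _; rewrite /mul_op.
  by rewrite mulmxDr scalemxAr.
Qed.

(** Jensen bounds the square of the average by the average of the square, and [integral_avg] removes
    the average: averaging is a contraction. *)
Lemma energy_avg_le p j (u : fct p) : (j <= N)%N -> cmeas u ->
  (energy (avg j u) <= energy u)%E.
Proof.
move=> jN mu; have part (f : pt -> R) : measurable_fun (cube R N) f ->
   (\int[lebesgue N]_(k in cube R N) (ravg j f k ^+ 2)%:E <=
    \int[lebesgue N]_(k in cube R N) (f k ^+ 2)%:E)%E.
  move=> mf.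
  have mf2 : measurable_fun (cube R N) (fun k => (f k ^+ 2)%:E).
    exact/measurable_EFinP/measurable_funX.
  have f20 k : cube R N k -> (0 <= (f k ^+ 2)%:E)%E by rewrite lee_fin sqr_ge0.
  rewrite -(@integral_avg R N j (fun k => (f k ^+ 2)%:E))//.
  apply: ge0_le_integral => //.
  - by move=> k _; rewrite lee_fin sqr_ge0.
  - apply/measurable_EFinP/measurable_funX; exact: measurable_ravg.
  - exact: (@measurable_avg R N j (fun k => (f k ^+ 2)%:E)).
  - by move=> k ck; exact: ravg_sqr_le.
rewrite !energyE//; last exact: cmeas_avg.
apply: lee_sum => i _; have [m1 m2] := mu i; apply: leeD.
- by under eq_integral do rewrite mxE; exact: part m1.
- by under eq_integral do rewrite mxE; exact: part m2.
Qed.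

(** Each real or imaginary part has its square dominated by [sqnorm]; the finitely many exceptional
    null sets are then united. *)
Lemma ae_avgable p j (u : fct p) : (j <= N)%N -> L2 u ->
  \forall k \ae (lebesgue N : set pt -> \bar R), cube R N k -> avgable j u k.
Proof.
move=> jN [mu eu].
have fin (i : 'I_p) : (\int[lebesgue N]_(k in cube R N) (complex.Re (u k i ord0) ^+ 2)%:E < +oo)%E
   /\ (\int[lebesgue N]_(k in cube R N) (complex.Im (u k i ord0) ^+ 2)%:E < +oo)%E.
  have [m1 m2] := mu i.
  split; apply: le_lt_trans eu; apply: ge0_le_integral => //;
    try (by move=> k _; rewrite lee_fin sqr_ge0);
    try (exact: measurable_sqnorm);
    try (exact/measurable_EFinP/measurable_funX);
    move=> k _; rewrite lee_fin /sqnorm (bigD1 i)//= -addrA.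
  - by rewrite lerDl addr_ge0 ?sqr_ge0// sumr_ge0// => l _; rewrite addr_ge0 ?sqr_ge0.
  - rewrite addrCA lerDl addr_ge0 ?sqr_ge0// sumr_ge0// => l _; by rewrite addr_ge0 ?sqr_ge0.
have h (i : 'I_p) : \forall k \ae (lebesgue N : set pt -> \bar R), cube R N k ->
    cintegrable (fun x : Rpoint R j => u (splice x k) i ord0).
  have [m1 m2] := mu i; have [f1 f2] := fin i.
  apply: filterS2 (ae_splice_integrable jN m1 f1) (ae_splice_integrable jN m2 f2) => k h1 h2 ck.
  by split; [exact: h1|exact: h2].
have hall : \forall k \ae (lebesgue N : set pt -> \bar R), forall i : 'I_p, cube R N k ->
    cintegrable (fun x : Rpoint R j => u (splice x k) i ord0).
  exact: filter_forall.
by apply: filterS hall => k h' ck i b; rewrite ord1; exact: h'.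
Qed.

Lemma blin_avg p j : (j <= N)%N -> blin (avg j : fct p -> fct p).
Proof.
move=> jN; split.
- by move=> u [mu _]; exact: cmeas_avg.
- by exists 1 => // u [mu _]; rewrite mul1e; exact: energy_avg_le.
- move=> a u v Lu Lv; apply: filterS2 (ae_avgable jN Lu) (ae_avgable jN Lv) => k hu hv ck.
  by rewrite avgD ?avgZ//; [exact: hu|apply: avgableZ; exact: hu|exact: hv].
Qed.

Lemma blin_avg_op p q r j (F : pt -> 'M[C]_(p, q)) (G : pt -> 'M[C]_(q, r)) :
  (j <= N)%N -> mcont F -> mcont G -> blin (avg_op j F G).
Proof.
move=> jN uF uG.
have := blin_comp (blin_mul uF) (blin_comp (blin_avg q jN) (blin_mul uG)).
by apply: eq_blin.
Qed.

Lemma blin_bounded p (Phi : fct p -> fct p) : blin Phi -> bounded_operator Phi.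
Proof.
move=> bP; have [m [c c0 b] l] := bP; split => //.
- by move=> u Lu; exact: blin_L2.
- by move=> u v Lu Lv; exact: blin_eq.
- exists (Num.sqrt c) => u Lu; rewrite /L2norm -sqrtrM//.
  have Lpu := blin_L2 bP Lu; have [_ eu] := Lu; have [_ epu] := Lpu.
  apply: ler_wsqrtr; rewrite /Rintegral.
  rewrite -[c * _]/(c * fine (energy u)) -[X in X <= _]/(fine (energy (Phi u))).
  rewrite -lee_fin EFinM !fineK ?ge0_fin_numE//; exact: b.
Qed.

(** The constant of [bounded_operator] carries no sign, but $c \|u\|$ dominates a norm and is thus
    nonnegative, so the inequality can be squared. *)
Lemma bounded_energy p (Phi : fct p -> fct p) : bounded_operator Phi ->
  exists2 c : R, 0 <= c & forall u, L2 u -> (energy (Phi u) <= c%:E * energy u)%E.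
Proof.
move=> [m _ _ [c b]]; exists (c ^+ 2); first exact: sqr_ge0.
move=> u Lu; have [_ eu] := Lu; have [_ epu] := m u Lu.
have := b u Lu; rewrite /L2norm -[\int[_]_(_ in _) _]/(fine (energy (Phi u)))
  -[\int[_]_(_ in _) sqnorm (u _)]/(fine (energy u)) => h.
rewrite -[X in (X <= _)%E]fineK ?ge0_fin_numE// -[X in (_ <= _ * X)%E]fineK ?ge0_fin_numE//.
have e1 : 0 <= fine (energy (Phi u)) by apply: fine_ge0.
have e2 : 0 <= fine (energy u) by apply: fine_ge0.
rewrite -EFinM lee_fin -{1}(sqr_sqrtr e1) -(sqr_sqrtr e2) -exprMn.
by rewrite lerXn2r ?nnegrE ?sqrtr_ge0// (le_trans _ h)// sqrtr_ge0.
Qed.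

End Operators.

(** * Invertibility of E_j *)

Section Concentration.
Context {R : realType} {N : nat}.
Local Notation C := R[i].
Local Notation pt := (Rpoint R N).
Variables (j : nat) (k0 : pt).
Hypotheses (jN : (j <= N)%N) (ck0 : cube R N k0).

Definition localized (d : R) p (v : pt -> 'cV[C]_p) (k : pt) : 'cV[C]_p :=
  ((\1_(box j k0 d) k : R)%:C)%C *: v k.

Definition vol (d : R) : \bar R :=
  (\int[lebesgue N]_(k in cube R N) (\1_(box j k0 d) k)%:E)%E.

Lemma measurable_indic_box d (D : set pt) : measurable_fun D (\1_(box j k0 d) : pt -> R).
Proof. by apply: measurable_indic; exact: measurable_box. Qed.

(** This is what lets the indicator leave an average over the free coordinates. *)
Lemma indic_box_splice d i (x : Rpoint R i) k : (i <= j)%N ->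
  \1_(box j k0 d) (splice x k) = \1_(box j k0 d) k :> R.
Proof.
move=> ij; rewrite !indicE; congr (nat_of_bool _)%:R.
apply/idP/idP => /set_mem h; apply/mem_set => l jl; have := h l jl;
  by rewrite tnth_mktuple ltnNge (leq_trans ij jl).
Qed.

(** The box constrained in all coordinates lies inside this one and already has measure at least
    $d^N$ in the cube. *)
Lemma vol_gt0 d : 0 < d -> d <= 2^-1 -> (0 < vol d)%E.
Proof.
move=> d0 d1; apply: (@lt_le_trans _ _ (d ^+ N)%:E); first by rewrite lte_fin exprn_gt0.
apply: le_trans (integral_box_ge ck0 d0 d1) _.
have mE b : measurable b -> measurable_fun (cube R N) (fun k : pt => (\1_b k : R)%:E).
  by move=> mb; apply/measurable_EFinP; exact: measurable_indic.
apply: ge0_le_integral => //.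
- by apply: mE; exact: measurable_box.
- by apply: mE; exact: measurable_box.
- move=> k _; rewrite lee_fin !indicE ler_nat.
  case: (boolP (k \in box 0 k0 d)) => // /set_mem h.
  by rewrite mem_set// => l _; exact: h.
Qed.

Lemma vol_fin d : vol d \is a fin_num.
Proof.
rewrite ge0_fin_numE; last by apply: integral_ge0 => k _; rewrite lee_fin indicE.
rewrite /vol integral_indic//; last exact: measurable_box.
apply: (@le_lt_trans _ _ (lebesgue N (cube R N))); last by rewrite lebesgue_cube ltry.
apply: le_measure; rewrite ?inE//.
by apply: measurableI => //; exact: measurable_box.
Qed.

Lemma measurable_Eindic_box d :
  measurable_fun (cube R N) (fun k => (\1_(box j k0 d) k : R)%:E).
Proof. apply/measurable_EFinP. exact: measurable_indic_box. Qed.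
#[local] Hint Resolve measurable_Eindic_box : core.

Lemma localized_sqnorm d p (v : pt -> 'cV[C]_p) k :
  sqnorm (localized d v k) = \1_(box j k0 d) k * sqnorm (v k).
Proof.
rewrite sqnormZ /= expr0n addr0; congr (_ * _).
by rewrite indicE; case: (_ \in _); rewrite ?expr1n ?expr0n.
Qed.

Lemma cmeas_localized d p (v : pt -> 'cV[C]_p) : cmeas v -> cmeas (localized d v).
Proof.
move=> mv i; have [m1 m2] := mv i; split.
- under eq_fun do rewrite mxE complexReM /= mul0r subr0.
  by apply: measurable_funM => //; exact: measurable_indic_box.
- under eq_fun do rewrite mxE complexImM /= mul0r addr0.
  by apply: measurable_funM => //; exact: measurable_indic_box.
Qed.

Lemma energy_localized_le d p (v : pt -> 'cV[C]_p) (t : R) : 0 <= t -> cmeas v ->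
  (forall k, cube R N k -> box j k0 d k -> sqnorm (v k) <= t) ->
  (energy (localized d v) <= t%:E * vol d)%E.
Proof.
move=> t0 mv hv; rewrite /energy /vol -ge0_integralZl_EFin//.
apply: ge0_le_integral => //.
- by move=> k _; rewrite lee_fin sqnorm_ge0.
- by apply: measurable_sqnorm; exact: cmeas_localized.
- by apply: measurable_funeM.
- move=> k ck; rewrite -EFinM lee_fin localized_sqnorm indicE.
  case: (boolP (_ \in _)) => [/set_mem bk|_]; last by rewrite mul0r mulr0.
  by rewrite mul1r mulr1 hv.
Qed.

Lemma energy_localized_cst d p (w : 'cV[C]_p) :
  (energy (localized d (fun=> w)) = (sqnorm w)%:E * vol d)%E.
Proof.
rewrite /energy /vol -ge0_integralZl_EFin ?sqnorm_ge0//.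
by apply: eq_integral => k _; rewrite localized_sqnorm mulrC EFinM.
Qed.

Lemma mcont_cmeas p (v : pt -> 'cV[C]_p) : mcont v -> cmeas v.
Proof. by move=> uv i; have [h1 h2] := uv i ord0; split; exact: ucont_measurable. Qed.

Lemma L2_localized d p (v : pt -> 'cV[C]_p) : mcont v -> L2 (localized d v).
Proof.
move=> uv; have mv := mcont_cmeas uv; split; first exact: cmeas_localized.
have [c c0 h] := mcont_sqnorm_le uv.
(* The vector [v k] is read as a one-column matrix applied to the 1 x 1 vector with entry 1, so the
   bound for matrix functions applies. *)
apply: (@le_lt_trans _ _ ((c * sqnorm (const_mx 1 : 'cV[C]_1))%:E * vol d)%E).
  apply: energy_localized_le => //; first by rewrite mulr_ge0 ?sqnorm_ge0.
  move=> k ck _; have := h k (const_mx 1) ck; congr (sqnorm _ <= _).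
  by apply/matrixP => a b; rewrite mxE big_ord1 !mxE mulr1 !ord1.
by rewrite lte_mul_pinfty// ?lee_fin ?mulr_ge0 ?sqnorm_ge0// -ge0_fin_numE ?vol_fin//
  integral_ge0// => k _; rewrite lee_fin indicE.
Qed.

(* The average over k_1, .., k_i includes the coordinate k_{j+1}, on which the
   localized has width 2d: this is the gain [d] over the trivial bound. *)
Lemma ravg_indic_box_le d i k : (j < i)%N -> (i <= N)%N -> 0 <= d -> cube R N k ->
  ravg i (\1_(box j k0 d)) k <= d *+ 2.
Proof.
move=> ji iN d0 ck; have jN' : (j < N)%N by exact: leq_trans iN.
have mb := @measurable_splice_section R N i _ k ck (@measurable_indic_box d (cube R N)).
have ib : (lebesgue i).-integrable (cube R i) (fun x => (\1_(box j k0 d) (splice x k) : R)%:E).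
  apply: (prob_bounded_integrable (measurable_cube (n := i)) (lebesgue_cube i) (c := 1)) => //.
  by move=> x _; rewrite indicE; case: (_ \in _); rewrite ?normr1 ?normr0.
rewrite -lee_fin /ravg /Rintegral fineK; last exact: integrable_fin_num.
apply: le_trans (integral_slab_le (Ordinal ji) (tnth k0 (Ordinal jN')) d0).
apply: ge0_le_integral => //.
- exact/measurable_EFinP.
- by apply/measurable_EFinP/measurable_indic; exact: measurable_slab.
- move=> x _; rewrite lee_fin !indicE ler_nat.
  case: (boolP (splice x k \in _)) => // /set_mem h.
  rewrite mem_set//=; have := h (Ordinal jN') (leqnn j).
  by rewrite tnth_mktuple ji -(tnth_nth 0 x (Ordinal ji)).
Qed.

(** With [h] the average of the indicator, the average of [chi g] is at most [c h]. In $h^2$, one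
    factor is at most [2d] by [ravg_indic_box_le], and the other integrates to the volume. *)
Lemma ravg_indic_mul_le d i (g : pt -> R) (c : R) : (j < i)%N -> (i <= N)%N -> 0 <= d ->
  measurable_fun (cube R N) g -> (forall k, cube R N k -> `|g k| <= c) ->
  (\int[lebesgue N]_(k in cube R N) (ravg i (fun k => \1_(box j k0 d) k * g k) k ^+ 2)%:E
   <= ((c ^+ 2 *+ 2) * d)%:E * vol d)%E.
Proof.
move=> ji iN d0 mg hg.
have c0 : 0 <= c by apply: le_trans (hg k0 ck0).
have mb := @measurable_indic_box d (cube R N).
have mbg : measurable_fun (cube R N) (fun k => \1_(box j k0 d) k * g k).
  exact: measurable_funM.
have ib k : cube R N k ->
    (lebesgue i).-integrable (cube R i) (fun x => (\1_(box j k0 d) (splice x k) : R)%:E).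
  move=> ck.
  apply: (prob_bounded_integrable (measurable_cube (n := i)) (lebesgue_cube i) (c := 1)).
    exact: (@measurable_splice_section R N i _ k ck mb).
  by move=> x _; rewrite indicE; case: (_ \in _); rewrite ?normr1 ?normr0.
have ibg k : cube R N k -> (lebesgue i).-integrable (cube R i)
    (fun x => (\1_(box j k0 d) (splice x k) * g (splice x k))%:E).
  move=> ck.
  apply: (prob_bounded_integrable (measurable_cube (n := i)) (lebesgue_cube i) (c := c)).
    exact: (@measurable_splice_section R N i _ k ck mbg).
  move=> x cx; rewrite indicE; case: (_ \in _); rewrite ?mul1r ?mul0r ?normr0//.
  by apply: hg; exact: cube_splice.
pose h := ravg i (\1_(box j k0 d)).
have h0 k : 0 <= h k by apply: Rintegral_ge0 => x _; rewrite indicE.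
have hle k : cube R N k -> `|ravg i (fun k => \1_(box j k0 d) k * g k) k| <= c * h k.
  move=> ck; apply: le_trans (le_normr_Rintegral _ _) _ => //; first exact: ibg.
  rewrite /h /ravg -RintegralZl//; last exact: ib.
  apply: le_Rintegral => //.
  - exact: (integrable_abse (ibg k ck)).
  - rewrite (_ : _ \o _ = fun x : Rpoint R i => (c%:E * (\1_(box j k0 d) (splice x k))%:E)%E)//.
    by apply: integrableZl => //; exact: ib.
  - move=> x cx; rewrite normrM mulrC indicE.
    case: (_ \in _); rewrite ?normr1 ?normr0 ?mulr1 ?mulr0//.
    by apply: hg; exact: cube_splice.
have hvol : (\int[lebesgue N]_(k in cube R N) (h k)%:E = vol d)%E.
  rewrite /vol -(@integral_avg R N i (fun k => (\1_(box j k0 d) k)%:E))//.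
  apply: eq_integral => k /set_mem ck; rewrite /h /ravg /Rintegral fineK//.
  by apply: integrable_fin_num => //; exact: ib.
have mh : measurable_fun (cube R N) h by exact: measurable_ravg.
have mEh : measurable_fun (cube R N) (fun k => (h k)%:E) by exact/measurable_EFinP.
have cd0 : 0 <= c ^+ 2 *+ 2 * d by rewrite mulr_ge0// mulrn_wge0// sqr_ge0.
rewrite -hvol -ge0_integralZl_EFin//; last by move=> k _; rewrite lee_fin.
apply: ge0_le_integral => //.
- by move=> k _; rewrite lee_fin sqr_ge0.
- by apply/measurable_EFinP/measurable_funX; exact: measurable_ravg.
- by apply: measurable_funeM.
- move=> k ck; rewrite -EFinM lee_fin.
  have h1 := hle k ck; have h2 : h k <= d *+ 2 by exact: ravg_indic_box_le.
  apply: (@le_trans _ _ ((c * h k) ^+ 2)).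
    rewrite -(real_normK (num_real _)) lerXn2r// nnegrE//.
    by rewrite mulr_ge0.
  rewrite exprMn (_ : _ * d * h k = c ^+ 2 * (d *+ 2 * h k)); last ring.
  by rewrite ler_wpM2l ?sqr_ge0// expr2 ler_wpM2r.
Qed.

(** The real and imaginary parts of each component contribute $2c^2$ each. *)
Lemma energy_avg_localized_le i p (v : pt -> 'cV[C]_p) : (j < i)%N -> (i <= N)%N -> mcont v ->
  exists2 c : R, 0 <= c & forall d, 0 <= d ->
    (energy (avg i (localized d v)) <= (c * d)%:E * vol d)%E.
Proof.
move=> ji iN uv; have [c c0 hc] := mcont_bounded uv.
exists (\sum_(l < p) (c ^+ 2 *+ 2 + c ^+ 2 *+ 2)).
  by apply: sumr_ge0 => l _; rewrite addr_ge0// mulrn_wge0// sqr_ge0.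
move=> d d0; have mv := mcont_cmeas uv.
have vol0 : (0 <= vol d)%E by apply: integral_ge0 => k _; rewrite lee_fin indicE.
rewrite energyE; last by apply: cmeas_avg; exact: cmeas_localized.
rewrite mulr_suml -sumEFin ge0_sume_distrl; last first.
  by move=> l _; rewrite lee_fin mulr_ge0// addr_ge0// mulrn_wge0// sqr_ge0.
apply: lee_sum => l _; have [m1 m2] := mv l.
rewrite mulrDl EFinD ge0_muleDl ?lee_fin ?mulr_ge0 ?mulrn_wge0 ?sqr_ge0//.
apply: leeD.
- have := ravg_indic_mul_le ji iN d0 m1 (fun k ck => (hc k l ord0 ck).1).
  congr (_ <= _)%E; apply: eq_integral => k _; congr (_ ^+ 2)%:E.
  by rewrite mxE /=; congr (fine _); apply: eq_integral => x _;
    rewrite mxE complexReM /= mul0r subr0.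
- have := ravg_indic_mul_le ji iN d0 m2 (fun k ck => (hc k l ord0 ck).2).
  congr (_ <= _)%E; apply: eq_integral => k _; congr (_ ^+ 2)%:E.
  by rewrite mxE /=; congr (fine _); apply: eq_integral => x _;
    rewrite mxE complexImM /= mul0r addr0.
Qed.

Lemma energy_avg_op_localized_le i p q r (F : pt -> 'M[C]_(p, q)) (G : pt -> 'M[C]_(q, r))
    (v : pt -> 'cV[C]_r) :
  (j < i)%N -> (i <= N)%N -> mcont F -> mcont G -> mcont v ->
  exists2 c : R, 0 <= c & forall d, 0 <= d ->
    (energy (avg_op i F G (localized d v)) <= (c * d)%:E * vol d)%E.
Proof.
move=> ji iN uF uG uv.
have [c c0 hc] := energy_avg_localized_le ji iN (mcontM uG uv).
have [c' c'0 hc'] := mcont_sqnorm_le uF.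
exists (c' * c); first exact: mulr_ge0.
move=> d d0.
have E : mul_op G (localized d v) = localized d (fun k => G k *m v k).
  by apply/funext => k; rewrite /mul_op /localized scalemxAr.
have mb : cmeas (avg i (localized d (fun k => G k *m v k))).
  by apply/cmeas_avg/cmeas_localized/mcont_cmeas; exact: mcontM.
apply: (@le_trans _ _ (c'%:E * energy (avg i (localized d (fun k => G k *m v k))))%E).
  apply: energy_le => //.
    by rewrite /avg_op E; exact: (cmeas_mul uF mb).
  by move=> k ck; rewrite /avg_op E; exact: hc'.
by rewrite -mulrA EFinM -muleA lee_wpmul2l ?lee_fin// hc.
Qed.

End Concentration.

(** * The averages beyond [j], and the test-function argument *)

Section Tail.
Context {R : realType} {N M : nat}.
Local Notation C := R[i].
Local Notation pt := (Rpoint R N).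
Variable m : nat -> nat.
Implicit Types (A : forall i, pt -> 'M[C]_(M, m i)) (B : forall i, pt -> 'M[C]_(m i, M)).

Definition tail_op j A B (u : pt -> 'cV[C]_M) (k : pt) : 'cV[C]_M :=
  \sum_(j.+1 <= i < N.+1) avg_op i (A i) (B i) u k.

Lemma blin_tail_op j A B :
  (forall i, (j < i <= N)%N -> mcont (A i)) -> (forall i, (j < i <= N)%N -> mcont (B i)) ->
  blin (tail_op j A B).
Proof.
(* The range is repeated as a predicate so that each term carries the bounds under which [A i] and
   [B i] are continuous. *)
move=> uA uB; apply: (@eq_blin _ _ _ _
  (fun u k => \sum_(j.+1 <= i < N.+1 | (j.+1 <= i < N.+1)%N) avg_op i (A i) (B i) u k)).
  by move=> u k; rewrite /tail_op [RHS]big_nat.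
apply: blin_sum => i; rewrite ltnS => /andP[ji iN].
by apply: blin_avg_op => //; [apply: uA|apply: uB]; rewrite ji.
Qed.

Lemma sqnormN p (u : 'cV[C]_p) : sqnorm (- u) = sqnorm u.
Proof. by apply: eq_bigr => i _; rewrite mxE; case: (u i ord0) => x y /=; rewrite !sqrrN. Qed.

Lemma energyN p (u : pt -> 'cV[C]_p) : energy (fun k => - u k) = energy u.
Proof. by apply: eq_integral => k _; rewrite sqnormN. Qed.

Lemma vol_ge0 j (k0 : pt) d : (0 <= vol j k0 d)%E.
Proof. by apply: integral_ge0 => k _; rewrite lee_fin indicE. Qed.
#[local] Hint Resolve vol_ge0 : core.

Lemma energy_tail_localized_le j (k0 : pt) A B (v : pt -> 'cV[C]_M) : cube R N k0 ->
  (forall i, (j < i <= N)%N -> mcont (A i)) -> (forall i, (j < i <= N)%N -> mcont (B i)) ->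
  mcont v -> exists2 c : R, 0 <= c & forall d, 0 <= d ->
    (energy (tail_op j A B (localized j k0 d v)) <= (c * d)%:E * vol j k0 d)%E.
Proof.
move=> ck0 uA uB uv; rewrite /tail_op.
pose S r (u : pt -> 'cV[C]_M) k := \sum_(i <- r) avg_op i (A i) (B i) u k.
(* Boundedness of the partial sums is carried along because [energyD_le] asks for the measurability
   of their values. *)
suff [_ [c c0 hc]] : blin (S (index_iota j.+1 N.+1)) /\
    exists2 c : R, 0 <= c & forall d, 0 <= d ->
    (energy (S (index_iota j.+1 N.+1) (localized j k0 d v)) <= (c * d)%:E * vol j k0 d)%E.
  by exists c.
have : all (fun i => (j < i <= N)%N) (index_iota j.+1 N.+1).
  by apply/allP => i; rewrite mem_index_iota ltnS.
elim: index_iota => [_|i r IH].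
  have S0 u k : S [::] u k = 0 by rewrite /S big_nil.
  split; first by apply: eq_blin (blin0 M M) => u k; rewrite S0.
  exists 0 => // d d0; rewrite /energy.
  by under eq_integral do rewrite S0 sqnorm0; rewrite integral0 mul0r mul0e.
rewrite [all _ _]/= => /andP[ji {}/IH [bS [c c0 hc]]]; have /andP[ji' iN] := ji.
have SE u k : S (i :: r) u k = avg_op i (A i) (B i) u k + S r u k by rewrite /S big_cons.
have bi : blin (avg_op i (A i) (B i)) by apply: blin_avg_op => //; [apply: uA|apply: uB].
split; first by apply: eq_blin (blinD bi bS) => u k; rewrite SE.
have [c' c'0 hc'] := energy_avg_op_localized_le ck0 ji' iN (uA i ji) (uB i ji) uv.
exists (2 * c' + 2 * c); first by rewrite addr_ge0// mulr_ge0.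
move=> d d0; have Lv := L2_localized j k0 d uv.
rewrite (_ : S (i :: r) _ = fun k => avg_op i (A i) (B i) (localized j k0 d v) k +
  S r (localized j k0 d v) k); last by apply/funext => k; rewrite SE.
have [m1 _ _] := bi; have [m2 _ _] := bS.
apply: le_trans (energyD_le (m1 _ Lv) (m2 _ Lv)) _.
rewrite mulrDl -!mulrA ge0_double_muleDl ?mulr_ge0//.
by apply: leeD; rewrite lee_wpmul2l ?lee_fin// ?hc ?hc'.
Qed.

Lemma ucont_sqnorm p (v : pt -> 'cV[C]_p) : mcont v -> ucont (fun k => sqnorm (v k)).
Proof.
move=> uv; apply: ucont_sum => i; have [h1 h2] := uv i ord0.
by apply: ucontD; under eq_fun do rewrite expr2; exact: ucontM.
Qed.

(** A point of the box may be far from [k0] in its first [j] coordinates. As [G] ignores them, they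
    are replaced by those of [k0], and continuity at [k0] applies to the resulting point [k1]. *)
Lemma avg_const_small j p (G : pt -> 'cV[C]_p) (k0 : pt) (e : R) : cube R N k0 ->
  mcont G -> (forall (x : Rpoint R j) k, G (splice x k) = G k) ->
  G k0 = 0 -> 0 < e ->
  exists2 d0 : R, 0 < d0 & forall d, d < d0 -> forall k, cube R N k -> box j k0 d k ->
    sqnorm (G k) <= e.
Proof.
move=> ck0 uG Gsp G0 e0.
have [d0 d00 hd] := ucont_sqnorm uG e0; exists d0 => // d dd0 k ck bk.
pose x0 : Rpoint R j := [tuple nth 0 k0 i | i < j].
pose k1 := splice x0 k.
have nth0 (i : 'I_N) : nth 0 k0 i = tnth k0 i by rewrite -tnth_nth.
have k1E (i : 'I_N) : tnth k1 i = if (i < j)%N then tnth k0 i else tnth k i.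
  rewrite tnth_mktuple; case: ltnP => // ij.
  by rewrite -(tnth_nth 0 x0 (Ordinal ij)) tnth_mktuple /= nth0.
have ck1 : cube R N k1 by move=> i; rewrite k1E; case: ifP.
have := hd k1 k0 ck1 ck0; rewrite G0 sqnorm0 subr0 Gsp => h.
apply: le_trans (ler_norm _) _; apply/ltW/h => i; rewrite k1E.
case: ltnP => ij; first by rewrite subrr normr0.
exact: le_lt_trans (bk i ij) dd0.
Qed.

(* If E(k0) w = 0, the test function is u = chi X w, for which
   u + X <Y u>_j = chi X E w. *)
Lemma coercive_unitmx q j (X : pt -> 'M[C]_(M, q)) (Y : pt -> 'M[C]_(q, M)) A B (c : R) :
  (j <= N)%N -> mcont X -> mcont Y ->
  (forall i, (j < i <= N)%N -> mcont (A i)) -> (forall i, (j < i <= N)%N -> mcont (B i)) ->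
  0 <= c ->
  (forall u, L2 u -> (energy u <= c%:E *
     energy (fun k => (u k + avg_op j X Y u k) + tail_op j A B u k)%R)%E) ->
  forall k, cube R N k -> 1%:M + avg j (fun k => Y k *m X k) k \in unitmx.
Proof.
move=> jN uX uY uA uB c0 hT k0 ck0.
pose E k : 'M[C]_q := 1%:M + avg j (fun k => Y k *m X k) k.
have uE : mcont E by apply: mcontD; [exact: mcont_cst|apply/mcont_avg/mcontM].
rewrite -/(E k0) unitmxE unitfE; apply/eqP => detE.
have [w w0 Ew] : exists2 w : 'cV[C]_q, w != 0 & E k0 *m w = 0.
  (* [det0P] provides a row vector killed from the left; transposition turns it into a kernel vector
     of [E k0]. *)
  have : \det (E k0)^T == 0 by rewrite det_tr detE.
  move/det0P => [v v0 vE]; exists v^T; first by rewrite trmx_eq0.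
  by apply: trmx_inj; rewrite trmx_mul trmxK vE trmx0.
have s0 : 0 < sqnorm w.
  rewrite lt_neqAle sqnorm_ge0 andbT eq_sym; apply: contraNneq w0.
  by move/sqnorm_eq0 ->.
set s := sqnorm w in s0.
have uw : mcont (fun _ : pt => w) by exact: mcont_cst.
pose v k := X k *m w.
have uv : mcont v by exact: mcontM.
pose G k := E k *m w.
have uG : mcont G by exact: mcontM.
have Gsp (x : Rpoint R j) k : G (splice x k) = G k by rewrite /G /E avg_splice.
have [ct ct0 hct] := energy_tail_localized_le ck0 uA uB uv.
have [cX cX0 hX] := mcont_sqnorm_le uX.
have [cY cY0 hY] := mcont_sqnorm_le uY.
(* These collect the coefficients of [e] and [d] in the final bound on the energy of [chi w]. The
   [+ 1] keeps [D2] positive, since [s] is divided by it. *)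
pose D1 := 2 + 4 * cY * c * cX; pose D2 := 4 * cY * c * ct + 1.
have D10 : 0 < D1 by rewrite /D1 ltr_pwDl// !mulr_ge0.
have D20 : 0 < D2 by rewrite /D2 ltr_wpDl// !mulr_ge0.
(* Both [D1 * e] and [D2 * d] will be at most [s / 4], so that the final bound reads
   [s <= s / 2]. *)
pose e := s / (4 * D1).
have e0 : 0 < e by rewrite divr_gt0// mulr_gt0.
have [d0 d00 hd0] := avg_const_small ck0 uG Gsp Ew e0.
(* In turn: strictly below [d0], for the smallness of [E w] on the box; at most 1/2, for a positive
   volume; and small enough for [D2 * d]. *)
pose d := Num.min (d0 / 2) (Num.min 2^-1 (s / (4 * D2))).
have d_gt0 : 0 < d by rewrite !lt_min !divr_gt0// ?mulr_gt0// invr_gt0 ltr0n.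
have [dd0 d1 d2] : [/\ d < d0, d <= 2^-1 & d <= s / (4 * D2)].
  split.
  - by apply: (@le_lt_trans _ _ (d0 / 2)); [rewrite ge_min lexx|lra].
  - by rewrite !ge_min lexx orbT.
  - by rewrite !ge_min lexx !orbT.
pose u := localized j k0 d v.
have Lu : L2 u by exact: L2_localized.
have [mu _] := Lu.
have volgt := vol_gt0 j ck0 d_gt0 d1; have volfin := vol_fin j k0 d.
have avgE k : cube R N k -> avg j (mul_op Y u) k =
    localized j k0 d (fun k => (E k - 1%:M) *m w) k.
  move=> ck; rewrite /localized.
  rewrite (_ : mul_op Y u = fun k => (Y k *m X k) *m
      (((\1_(box j k0 d) k : R)%:C)%C *: w)); last first.
    by apply/funext => k'; rewrite /mul_op /u /localized /v -!scalemxAr mulmxA.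
  rewrite avgMr; last 2 first.
  - by move=> x; rewrite indic_box_splice.
  - by apply: mcont_avgable => //; exact: mcontM.
  by rewrite /E addrAC subrr add0r scalemxAr.
have TE k : cube R N k -> u k + avg_op j X Y u k = localized j k0 d (fun k => X k *m G k) k.
  move=> ck; rewrite /avg_op avgE// /u /localized /v -scalemxAr -scalerDr.
  by rewrite -mulmxDr mulmxBl mul1mx addrCA subrr addr0.
have e1 : (energy (fun k => u k + avg_op j X Y u k)%R <= (cX * e)%:E * vol j k0 d)%E.
  rewrite (_ : energy _ = energy (localized j k0 d (fun k => X k *m G k))).
    apply: energy_localized_le.
    - by rewrite mulr_ge0// ltW.
    - by apply/mcont_cmeas; exact: mcontM.
    - move=> k ck bk; apply: le_trans (hX k (G k) ck) _.
      by rewrite ler_wpM2l// (hd0 d).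
  by apply: eq_integral => k /set_mem ck; rewrite TE.
have e2 := hct d (ltW d_gt0); rewrite -/u in e2.
have m1 : cmeas (fun k => u k + avg_op j X Y u k).
  have [h _ _] := blinD (@blin_id _ N M) (blin_avg_op jN uX uY); exact: h.
have m2 : cmeas (tail_op j A B u) by have [h _ _] := blin_tail_op uA uB; exact: h.
have m3 : cmeas (avg j (mul_op Y u)) by apply/cmeas_avg/cmeas_mul.
have e3 : (energy u <= (c * (2 * (cX * e) + 2 * (ct * d)))%:E * vol j k0 d)%E.
  apply: le_trans (hT u Lu) _; rewrite EFinM -muleA lee_wpmul2l ?lee_fin//.
  apply: le_trans (energyD_le m1 m2) _.
  rewrite (ge0_double_muleDl _ (mulr_ge0 cX0 (ltW e0)) (mulr_ge0 ct0 (ltW d_gt0))).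
  by apply: leeD; rewrite lee_wpmul2l ?lee_fin.
have e4 : (energy (avg j (mul_op Y u)) <=
    (cY * (c * (2 * (cX * e) + 2 * (ct * d))))%:E * vol j k0 d)%E.
  apply: le_trans (energy_avg_le jN (cmeas_mul uY mu)) _.
  apply: (@le_trans _ _ (cY%:E * energy u)%E).
    by apply: energy_le => // [|k ck]; [exact: cmeas_mul|exact: hY].
  by rewrite EFinM -muleA lee_wpmul2l ?lee_fin.
have e5 : (energy (localized j k0 d G) <= e%:E * vol j k0 d)%E.
  apply: energy_localized_le; first exact: ltW.
    exact: mcont_cmeas.
  by move=> k ck bk; apply: (hd0 d).
(* Since $\langle Y u\rangle_j = \chi (E - I) w$, the vector $\chi w$ is $\chi E w - \langle Y
   u\rangle_j$. The first term is small by continuity, the second by the lower bound of the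
   operator. *)
have e6 : (s%:E * vol j k0 d <= (D1 * e + D2 * d)%:E * vol j k0 d)%E.
  rewrite -energy_localized_cst.
  rewrite (_ : energy _ = energy (fun k => localized j k0 d G k +
      - avg j (mul_op Y u) k)%R); last first.
    apply: eq_integral => k /set_mem ck; rewrite avgE// /localized -scalerBr.
    by rewrite mulmxBl mul1mx opprB addrCA subrr addr0.
  apply: le_trans (energyD_le _ _) _.
  - by apply/cmeas_localized/mcont_cmeas.
  - have := cmeasZ (-1) m3; by under eq_fun do rewrite scaleN1r.
  rewrite energyN.
  apply: (@le_trans _ _ ((2 * e +
     2 * (cY * (c * (2 * (cX * e) + 2 * (ct * d)))))%:E * vol j k0 d)%E).
    have h1 : 0 <= 2 * (cX * e) by exact: mulr_ge0 (ler0n _ 2) (mulr_ge0 cX0 (ltW e0)).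
    have h2 : 0 <= 2 * (ct * d) by exact: mulr_ge0 (ler0n _ 2) (mulr_ge0 ct0 (ltW d_gt0)).
    rewrite (ge0_double_muleDl _ (ltW e0) (mulr_ge0 cY0 (mulr_ge0 c0 (addr_ge0 h1 h2)))).
    by apply: leeD; rewrite lee_wpmul2l ?lee_fin.
  rewrite lee_wpmul2r// lee_fin /D1 /D2.
  rewrite -subr_ge0 (_ : _ - _ = d); first exact: ltW.
  ring.
have : s <= D1 * e + D2 * d.
  move: e6; rewrite -(fineK volfin) -!EFinM lee_fin ler_pM2r//.
  by rewrite fine_gt0// volgt -ge0_fin_numE.
have -> : D1 * e = s / 4 by rewrite /e; field; rewrite gt_eqF.
have : D2 * d <= s / 4.
  have -> : s / 4 = D2 * (s / (4 * D2)) by field; rewrite gt_eqF.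
  by rewrite ler_pM2l.
lra.
Qed.

End Tail.

(** * Factorization *)

Section Factorization.
Context {R : realType} {N M q : nat}.
Local Notation C := R[i].
Local Notation pt := (Rpoint R N).
Variables (j : nat) (X : pt -> 'M[C]_(M, q)) (Y : pt -> 'M[C]_(q, M)).
Hypotheses (jN : (j <= N)%N) (uX : mcont X) (uY : mcont Y).

Let E k : 'M[C]_q := 1%:M + avg j (fun k' => Y k' *m X k') k.

Hypothesis Eu : forall k, cube R N k -> E k \in unitmx.

Let Esplice (x : Rpoint R j) k : E (splice x k) = E k.
Proof. by rewrite /E avg_splice. Qed.

Let avgYX k : avg j (fun k' => Y k' *m X k') k = E k - 1%:M.
Proof. by rewrite /E addrAC subrr add0r. Qed.

Let rank_one u k := u k + avg_op j X Y u k.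
Let rank_one_inv u k := u k - avg_op j (fun k' => X k' *m invmx (E k')) Y u k.

(** Both inversion identities are instances: [b] is $\langle Y u\rangle_j$ for the factor, whose
    average then becomes $E \langle Y u\rangle_j$, and $-E^{-1}\langle Y u\rangle_j$ for its
    inverse, as in the Woodbury formula. It holds almost everywhere because [Y u] is only square
    integrable. *)
Let ae_avg_shift u (b : pt -> 'cV[C]_q) : L2 u ->
  (forall (x : Rpoint R j) k, b (splice x k) = b k) ->
  \forall k \ae (lebesgue N : set pt -> \bar R), cube R N k ->
    avg j (mul_op Y (fun k => u k + X k *m b k)) k =
    avg j (mul_op Y u) k + (E k - 1%:M) *m b k.
Proof.
move=> Lu bs; have := ae_avgable jN (blin_L2 (blin_mul uY) Lu).
apply: filterS => k h ck; rewrite -avgYX.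
have iYX : avgable j (fun k' => Y k' *m X k') k by apply: mcont_avgable => //; exact: mcontM.
rewrite -(avgMr (c := b))//.
have hk := h ck; have ib : avgable j (fun k => (Y k *m X k) *m b k) k.
  by apply: avgableMr => // x; exact: bs.
rewrite -avgD//.
by congr (avg j _ k); apply/funext => k'; rewrite /mul_op mulmxDr mulmxA.
Qed.

Lemma rank_one_invK u : L2 u -> L2eq (rank_one_inv (rank_one u)) u.
Proof.
move=> Lu; have := ae_avg_shift Lu (fun x k => avg_splice (mul_op Y u) x k (leqnn j)).
apply: filterS => k h ck; rewrite /rank_one_inv /avg_op h// mulmxBl mul1mx addrCA subrr addr0.
by rewrite -mulmxA mulKmx ?Eu// /rank_one /avg_op addrK.
Qed.

Lemma rank_oneK u : L2 u -> L2eq (rank_one (rank_one_inv u)) u.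
Proof.
move=> Lu; pose b k := - (invmx (E k) *m avg j (mul_op Y u) k).
have bs (x : Rpoint R j) k : b (splice x k) = b k by rewrite /b Esplice avg_splice.
have E1 : rank_one_inv u = fun k => u k + X k *m b k.
  by apply/funext => k; rewrite /rank_one_inv /avg_op /b mulmxN mulmxA.
have := ae_avg_shift Lu bs; apply: filterS => k h ck.
rewrite /rank_one /avg_op E1 h// /b !mulmxN mulmxBl mul1mx mulKVmx ?Eu//.
by rewrite opprB addrCA subrr addr0 addrNK.
Qed.

Lemma blin_rank_one : blin rank_one.
Proof. by apply: blinD; [exact: blin_id|exact: blin_avg_op]. Qed.

Lemma mcont_rank_one_gen : mcont E.
Proof. by apply: mcontD; [exact: mcont_cst|apply/mcont_avg/mcontM]. Qed.

Lemma blin_rank_one_inv : blin rank_one_inv.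
Proof.
have uF : mcont (fun k' => - (X k' *m invmx (E k'))).
  by apply/mcontN/mcontM => //; apply: mcont_invmx => //; exact: mcont_rank_one_gen.
apply: eq_blin (blinD (@blin_id _ N M) (blin_avg_op jN uF uY)) => u k.
by rewrite /rank_one_inv /avg_op mulNmx.
Qed.

(** The new coefficients satisfy $A'_i + X E^{-1}\langle Y A_i\rangle_j = A_i$, and the extra term
    is what the rank-one factor produces from $A'_i \langle B_i u\rangle_i$, because $\langle B_i
    u\rangle_i$ leaves $\langle\cdot\rangle_j$ for $i > j$. *)
Lemma rank_one_tail (m : nat -> nat) (A : forall i, pt -> 'M[C]_(M, m i))
    (B : forall i, pt -> 'M[C]_(m i, M)) u :
  (forall i, (j < i <= N)%N -> mcont (A i)) ->
  (forall i, (j < i <= N)%N -> mcont (B i)) -> L2 u ->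
  L2eq (fun k => rank_one u k + tail_op j A B u k)
    (rank_one (fun k => u k + tail_op j (fun i k =>
       A i k - X k *m invmx (E k) *m avg j (fun k' => Y k' *m A i k') k) B u k)).
Proof.
move=> uA uB Lu.
set A' := fun i k => _ - _.
pose b i := avg i (mul_op (B i) u).
have := ae_avgable jN (blin_L2 (blin_mul uY) Lu).
apply: filterS => k h ck.
have iYX : avgable j (fun k' => Y k' *m X k') k by apply: mcont_avgable => //; exact: mcontM.
(* Averaging [Y A'] gives $\langle Y A_i\rangle_j - (E - I) E^{-1} \langle Y A_i\rangle_j$, which
   collapses to $E^{-1} \langle Y A_i\rangle_j$. *)
have YA' i : (j < i <= N)%N ->
    avgable j (fun k => Y k *m A' i k) k /\
    avg j (fun k => Y k *m A' i k) k = invmx (E k) *m avg j (fun k => Y k *m A i k) k.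
  move=> ji; pose a k := - (invmx (E k) *m avg j (fun k' => Y k' *m A i k') k).
  have as' (x : Rpoint R j) : a (splice x k) = a k by rewrite /a Esplice avg_splice.
  have iYA : avgable j (fun k => Y k *m A i k) k.
    by apply: mcont_avgable => //; apply: mcontM => //; exact: uA.
  rewrite (_ : (fun k => Y k *m A' i k) =
     fun k => Y k *m A i k + (Y k *m X k) *m a k); last first.
    by apply/funext => k'; rewrite mulmxBr /a mulmxN !mulmxA.
  have i2 : avgable j (fun k => (Y k *m X k) *m a k) k by exact: avgableMr.
  split; first exact: avgableD.
  rewrite avgD// (avgMr as' iYX) avgYX mulmxBl mul1mx /a mulmxN mulKVmx ?Eu//.
  by rewrite opprK addrA subrr add0r.
have bs i (x : Rpoint R j) : (j < i <= N)%N -> b i (splice x k) = b i k.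
  by move=> /andP[ji _]; rewrite /b avg_splice// ltnW.
have avgv : avg j (mul_op Y (fun k => u k + tail_op j A' B u k)) k =
    avg j (mul_op Y u) k + \sum_(j.+1 <= i < N.+1 | (j.+1 <= i < N.+1)%N)
      (invmx (E k) *m avg j (fun k => Y k *m A i k) k) *m b i k.
  rewrite (_ : mul_op Y _ = fun k => mul_op Y u k +
      \sum_(j.+1 <= i < N.+1 | (j.+1 <= i < N.+1)%N) (Y k *m A' i k) *m b i k); last first.
    apply/funext => k'; rewrite /mul_op mulmxDr; congr (_ + _).
    rewrite /tail_op big_nat mulmx_sumr; apply: eq_bigr => i _.
    by rewrite /avg_op -/(b i) mulmxA.
  have it i : (j.+1 <= i < N.+1)%N -> avgable j (fun k => (Y k *m A' i k) *m b i k) k.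
    rewrite ltnS => ji; have [h1 _] := YA' i ji.
    exact: (avgableMr (fun x => bs i x ji) h1).
  rewrite avgD; [|exact: h|exact: avgable_sum]; congr (_ + _).
  rewrite avg_sum//; apply: eq_bigr => i; rewrite ltnS => ji; have [h1 h2] := YA' i ji.
  by rewrite (avgMr (fun x => bs i x ji) h1) h2.
rewrite /rank_one /avg_op avgv mulmxDr -!addrA; congr (_ + _).
rewrite addrCA; congr (_ + _); rewrite /tail_op big_nat [in RHS]big_nat mulmx_sumr -big_split/=.
apply: eq_bigr => i _; rewrite /avg_op -/(b i) /A' mulmxBl !mulmxA.
by rewrite subrK.
Qed.

End Factorization.

(** * The chain of operators [T_0, .., T_N] *)

Section MainProof.
Context {R : realType} {N M : nat}.
Local Notation C := R[i].
Local Notation pt := (Rpoint R N).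
Variables (m : nat -> nat) (A0 : pt -> 'M[C]_M).
Variables (A : forall j, pt -> 'M[C]_(M, m j)) (B : forall j, pt -> 'M[C]_(m j, M)).
Hypotheses (uA0 : mcont A0).
Hypothesis uA : forall i, (0 < i <= N)%N -> mcont (A i).
Hypothesis uB : forall i, (0 < i <= N)%N -> mcont (B i).

Local Notation Arec := (Arec A0 A B).

(** This is all that is retained of the assumed invertibility; the inverse is later rebuilt from the
    factors. *)
Definition coercive (Phi : (pt -> 'cV[C]_M) -> (pt -> 'cV[C]_M)) :=
  exists2 c : R, 0 <= c & forall u, L2 u -> (energy u <= c%:E * energy (Phi u))%E.

(** The operator [T_j] of the overview. *)
Definition remainder_op j (u : pt -> 'cV[C]_M) (k : pt) := u k + tail_op j (Arec j) B u k.

Lemma blin_integral_op : blin (integral_op A0 A B).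
Proof. exact: blinD (blin_mul uA0) (blin_tail_op uA uB). Qed.

Lemma invertible_coercive : invertible_operator (integral_op A0 A B) ->
  coercive (integral_op A0 A B).
Proof.
move=> [Psi [bPsi K _]]; have [c c0 h] := bounded_energy bPsi.
exists c => // u Lu; have L1 := blin_L2 blin_integral_op Lu.
have [mP _ _ _] := bPsi; have [mu _] := Lu; have [mPu _] := mP _ L1.
by rewrite -(L2eq_energy mPu mu (K u Lu)); exact: h.
Qed.

(** From $\|u\|^2 \le c \|\Psi\Theta u\|^2 \le c c' \|\Theta u\|^2$: the right factor inherits the
    lower bound. *)
Lemma coercive_comp Phi Psi Theta : blin Psi -> blin Theta -> coercive Phi ->
  (forall u, L2 u -> cmeas (Phi u)) ->
  (forall u, L2 u -> L2eq (Phi u) (Psi (Theta u))) -> coercive Theta.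
Proof.
move=> bP bT [c c0 hc] mPhi e; have [mP [c' c'0 hc'] _] := bP.
exists (c * c'); first exact: mulr_ge0.
move=> u Lu; apply: le_trans (hc u Lu) _.
have LT := blin_L2 bT Lu.
rewrite (L2eq_energy (mPhi u Lu) (mP _ LT) (e u Lu)) EFinM -muleA.
by rewrite lee_wpmul2l ?lee_fin ?hc'.
Qed.

Hypothesis co : coercive (integral_op A0 A B).

Lemma A0_unit k : cube R N k -> A0 k \in unitmx.
Proof.
move=> ck; have [c c0 hc] := co.
have u1 : mcont (fun _ : pt => 1%:M : 'M[C]_M) by exact: mcont_cst.
have uX : mcont (fun k => A0 k - 1%:M) by apply: mcontD => //; exact: mcont_cst.
have := coercive_unitmx (leq0n N) uX u1 uA uB c0 _ ck.
rewrite avg0 mul1mx addrCA subrr addr0; apply => u Lu.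
rewrite (_ : (fun k => _) = integral_op A0 A B u); first exact: hc.
apply/funext => k'; rewrite /integral_op /tail_op; congr (_ + _).
by rewrite /avg_op avg0 /mul_op mul1mx mulmxBl mul1mx addrCA subrr addr0.
Qed.

Lemma blin_remainder_op j : (forall i, (0 < i <= N)%N -> mcont (Arec j i)) ->
  blin (remainder_op j).
Proof.
move=> uAj; apply: blinD; first exact: blin_id.
apply: blin_tail_op => i /andP[ji iN]; [apply: uAj|apply: uB];
  by rewrite iN (leq_ltn_trans _ ji).
Qed.

Lemma integral_op_remainder u k : cube R N k ->
  integral_op A0 A B u k = mul_op A0 (remainder_op 0 u) k.
Proof.
move=> ck; rewrite /integral_op /mul_op /remainder_op mulmxDr; congr (_ + _).
rewrite /tail_op mulmx_sumr; apply: eq_bigr => i _.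
by rewrite /avg_op /= mulmxA mulKVmx ?A0_unit.
Qed.

(** The remaining tail keeps the coefficients of stage [j]; this is the shape that [coercive_unitmx]
    and [rank_one_tail] expect. *)
Lemma remainder_opS j u k : (j < N)%N -> remainder_op j u k =
  factor_op A0 A B j.+1 u k + tail_op j.+1 (Arec j) B u k.
Proof.
by move=> jN; rewrite /remainder_op /tail_op big_ltn// /factor_op addrA.
Qed.

(** The three properties advance together. Coercivity of [T_j] makes $E_{j+1}$ invertible, this
    makes the next coefficients continuous and the factorization of [T_j] valid, and the
    factorization passes coercivity to [T_{j+1}]. *)
Let stage j := [/\ forall i, (0 < i <= N)%N -> mcont (Arec j i),
  coercive (remainder_op j) &
  forall i k, (0 < i <= j)%N -> cube R N k -> Emx A0 A B i k \in unitmx].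

Let factor_remainder j u : (j < N)%N -> stage j ->
  (forall k, cube R N k -> Emx A0 A B j.+1 k \in unitmx) -> L2 u ->
  L2eq (remainder_op j u) (factor_op A0 A B j.+1 (remainder_op j.+1 u)).
Proof.
move=> jN [uAj _ _] Eu Lu.
have uAt i : (j.+1 < i <= N)%N -> mcont (Arec j i).
  by move=> /andP[ji iN]; apply: uAj; rewrite iN (leq_ltn_trans _ ji).
have uBt i : (j.+1 < i <= N)%N -> mcont (B i).
  by move=> /andP[ji iN]; apply: uB; rewrite iN (leq_ltn_trans _ ji).
have := rank_one_tail jN (uAj j.+1 jN) (uB (i := j.+1) jN) Eu uAt uBt Lu.
by apply: filterS => k h ck; rewrite remainder_opS//; exact: h.
Qed.

Lemma stages j : (j <= N)%N -> stage j.
Proof.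
elim: j => [_|j IH jN].
  have uA00 i : (0 < i <= N)%N -> mcont (Arec 0 i).
    by move=> iN; apply: mcontM; [apply: mcont_invmx => // k; exact: A0_unit|exact: uA].
  split; [exact: uA00| |by move=> i k; case: i].
  apply: (coercive_comp (blin_mul uA0) (blin_remainder_op uA00) co).
    by have [] := blin_integral_op.
  by move=> u _; apply: aeW => k ck; exact: integral_op_remainder.
have st := IH (ltnW jN); have [uAj [c c0 hc] Eu] := st.
have uX : mcont (Arec j j.+1) by exact: uAj.
have uY : mcont (B j.+1) by exact: uB.
have lt0 i : (j.+1 < i <= N)%N -> (0 < i <= N)%N.
  by move=> /andP[ji ->]; rewrite (leq_ltn_trans _ ji).
have Ej k : cube R N k -> Emx A0 A B j.+1 k \in unitmx.
  move=> ck; apply: (coercive_unitmx jN uX uY (fun i h => uAj i (lt0 i h))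
    (fun i h => uB (lt0 i h)) c0 _ ck) => u Lu.
  have -> : (fun k => u k + avg_op j.+1 (Arec j j.+1) (B j.+1) u k +
      tail_op j.+1 (Arec j) B u k) = remainder_op j u.
    by apply/funext => k'; rewrite [RHS]remainder_opS.
  exact: hc.
have uAj1 i : (0 < i <= N)%N -> mcont (Arec j.+1 i).
  move=> iN; apply: mcontD; first exact: uAj.
  apply: mcontN; apply: mcontM; last by apply/mcont_avg/mcontM => //; exact: uAj.
  by apply: mcontM => //; apply: mcont_invmx => //; exact: mcont_rank_one_gen.
split; [exact: uAj1| |]; last first.
  move=> i k /andP[i0]; rewrite leq_eqVlt => /predU1P[->|ij]; first exact: Ej.
  by apply: Eu; rewrite i0.
apply: (coercive_comp (blin_rank_one jN uX uY) (blin_remainder_op uAj1)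
  (Phi := remainder_op j)); first by exists c.
  by have [] := blin_remainder_op uAj.
by move=> u Lu; exact: factor_remainder.
Qed.

Lemma E_unit j k : (0 < j <= N)%N -> cube R N k -> Emx A0 A B j k \in unitmx.
Proof. by move=> jN; have [_ _] := stages (leqnn N); exact. Qed.

(** The inverse factors are composed in reverse order, so the induction adds them at the right end
    of the list. *)
Lemma big_comp_rcons (T : Type) (F : nat -> T -> T) s j :
  \big[comp/id]_(i <- rcons s j) F i = (\big[comp/id]_(i <- s) F i) \o F j.
Proof.
by elim: s => [|i s IH]; rewrite ?rcons_cons !(big_cons, big_nil)// IH.
Qed.

Lemma remainder_op_factors j : (j <= N)%N ->
  let F := \big[comp/id]_(i <- index_iota j.+1 N.+1) factor_op A0 A B i in
  let G := \big[comp/id]_(i <- rev (index_iota j.+1 N.+1)) inv_factor_op A0 A B i in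
  [/\ blin F, blin G,
      forall u, L2 u -> L2eq (remainder_op j u) (F u),
      forall u, L2 u -> L2eq (G (remainder_op j u)) u &
      forall u, L2 u -> L2eq (remainder_op j (G u)) u].
Proof.
(* The induction descends from [j = N], where the tail is empty and [T_N] is the identity; the
   variable is the number of factors. *)
move=> jN; rewrite -(subKn jN); elim: (N - j)%N (leq_subr j N) => [|n IH] nN.
  have rN : remainder_op N = id.
    apply/funext => u; apply/funext => k.
    by rewrite /remainder_op /tail_op big_geq// addr0.
  rewrite subn0 /index_iota subnn /= !big_nil rN.
  by split; first [exact: blin_id|by move=> *; exact: L2eq_refl].
have [{IH}] := IH (ltnW nN); rewrite subnS; set l := (N - n)%N.
have l0 : (0 < l)%N by rewrite subn_gt0.
have lN : (l <= N)%N by exact: leq_subr.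
have lN' : (l.-1 < N)%N by rewrite prednK.
have -> : index_iota l.-1.+1 N.+1 = l :: index_iota l.+1 N.+1.
  by rewrite prednK// /index_iota subSn// subSS.
rewrite rev_cons big_comp_rcons big_cons.
set F := \big[comp/id]_(i <- _) _; set G := \big[comp/id]_(i <- _) _.
move=> bF bG e1 e2 e3 /=.
have lNP : (0 < l <= N)%N by rewrite l0.
have st := stages (ltnW lN'); have [uAl _ _] := st.
have uX : mcont (Arec l.-1 l) by exact: uAl.
have uY := uB lNP; have Eu k (ck : cube R N k) := E_unit lNP ck.
have bf : blin (factor_op A0 A B l) by exact: blin_rank_one.
have bg : blin (inv_factor_op A0 A B l) by exact: blin_rank_one_inv.
have [uAl' _ _] := stages lN; have br := blin_remainder_op uAl'.
have br1 := blin_remainder_op uAl.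
have fr u : L2 u -> L2eq (remainder_op l.-1 u) (factor_op A0 A B l (remainder_op l u)).
  move=> Lu; have := @factor_remainder l.-1 u lN' st; rewrite prednK//.
  by apply.
have Lf := blin_L2 bf; have Lg := blin_L2 bg; have Lr := blin_L2 br.
have LF := blin_L2 bF; have LG := blin_L2 bG; have Lr1 := blin_L2 br1.
split.
- exact: blin_comp.
- exact: blin_comp.
- move=> u Lu; apply: L2eq_trans (fr u Lu) _.
  exact: (blin_eq bf (Lr u Lu) (LF u Lu) (e1 u Lu)).
- move=> u Lu; apply: L2eq_trans (e2 u Lu).
  apply: (blin_eq bG (Lg _ (Lr1 u Lu)) (Lr u Lu)).
  apply: (@L2eq_trans _ _ _ _ (inv_factor_op A0 A B l (factor_op A0 A B l (remainder_op l u)))).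
    exact: (blin_eq bg (Lr1 u Lu) (Lf _ (Lr u Lu)) (fr u Lu)).
  by apply: rank_one_invK => //; exact: Lr.
- move=> u Lu; have L1 := Lg u Lu.
  apply: L2eq_trans (fr _ (LG _ L1)) _.
  apply: (@L2eq_trans _ _ _ _ (factor_op A0 A B l (inv_factor_op A0 A B l u))).
    exact: (blin_eq bf (Lr _ (LG _ L1)) L1 (e3 _ L1)).
  exact: rank_oneK.
Qed.

End MainProof.

Theorem theorem1p5 (R : realType) (N M : nat) (m : nat -> nat)
    (A0 : Rpoint R N -> 'M[R[i]]_M)
    (A : forall j : nat, Rpoint R N -> 'M[R[i]]_(M, m j))
    (B : forall j : nat, Rpoint R N -> 'M[R[i]]_(m j, M))
    (N_gt0 : (0 < N)%N) (M_gt0 : (0 < M)%N)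
    (m_gt0 : forall j : nat, (1 <= j <= N)%N -> (0 < m j)%N)
    (A0_cont : continuous_on_cube A0)
    (A_cont : forall j : nat, (1 <= j <= N)%N -> continuous_on_cube (A j))
    (B_cont : forall j : nat, (1 <= j <= N)%N -> continuous_on_cube (B j)) :
  bounded_operator (integral_op A0 A B) /\
  (invertible_operator (integral_op A0 A B) ->
   [/\ forall k, cube R N k -> A0 k \in unitmx,
       forall j k, (1 <= j <= N)%N -> cube R N k -> Emx A0 A B j k \in unitmx,
       op_eq (integral_op A0 A B) (mul_op A0 \o factors_op A0 A B)
     & inverse_operator (integral_op A0 A B)
         (inv_factors_op A0 A B \o mul_op (fun k => invmx (A0 k)))]).
Proof.
have uA0 := continuous_on_cube_mcont A0_cont.
have uA i (h : (0 < i <= N)%N) := continuous_on_cube_mcont (A_cont i h).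
have uB i (h : (0 < i <= N)%N) := continuous_on_cube_mcont (B_cont i h).
have bA := blin_integral_op uA0 uA uB.
split; first exact: blin_bounded.
move=> /(invertible_coercive uA0 uA uB) co.
have A0u k (ck : cube R N k) := A0_unit uA0 uA uB co ck.
have [bF bG e1 e2 e3] := remainder_op_factors uA0 uA uB co (leq0n N).
have uV := mcont_invmx A0u uA0.
have bm := blin_mul uA0; have bv := blin_mul uV.
have [uA1 _ _] := stages uA0 uA uB co (leq0n N).
have br := blin_remainder_op uB uA1.
(* What remains follows from [A = A_0 T_0] and the facts just obtained for [T_0]; almost everywhere
   equalities pass through the operators by [blin_eq]. *)
have Ar u : L2eq (integral_op A0 A B u) (mul_op A0 (remainder_op A0 A B 0 u)).
  by apply: aeW => k ck; exact: (integral_op_remainder uA0 uA uB co).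
have Lm := blin_L2 bm; have Lv := blin_L2 bv; have Lr := blin_L2 br.
have LF := blin_L2 bF; have LG := blin_L2 bG.
split.
- exact: A0u.
- by move=> j k; exact: (E_unit uA0 uA uB co).
- move=> u Lu; apply: L2eq_trans (Ar u) _.
  exact: (blin_eq bm (Lr u Lu) (LF u Lu) (e1 u Lu)).
- split.
  + exact: (blin_bounded (blin_comp bG bv)).
  + move=> u Lu; apply: L2eq_trans (e2 u Lu).
    apply: (blin_eq bG (Lv _ (blin_L2 bA Lu)) (Lr u Lu)); apply: aeW => k ck.
    rewrite /mul_op (integral_op_remainder uA0 uA uB co _ ck) /mul_op.
    by rewrite mulKmx ?A0u.
  + move=> u Lu; apply: L2eq_trans (Ar _) _.
    apply: (@L2eq_trans _ _ _ _ (mul_op A0 (mul_op (fun k => invmx (A0 k)) u))).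
      exact: (blin_eq bm (Lr _ (LG _ (Lv _ Lu))) (Lv _ Lu) (e3 _ (Lv _ Lu))).
    by apply: aeW => k ck; rewrite /mul_op mulKVmx ?A0u.
Qed.
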